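(* There exist an absolute constant $\alpha\ge 1$ and a deterministic online algorithm with recourse for the online minimum cost bipartite matching problem on the line that is $\alpha$-competitive and whose total number of reassignments over the whole request sequence is $O(n\log n)$ on every instance with $n$ requests (i.e. amortized recourse budget $O(n\log n)$).
   Context: Online minimum cost matching on the line: a finite set $S\subset\mathbb{R}$ of servers is known in advance. Requests $r_1,r_2,\dots,r_n\in\mathbb{R}$, with $n\le |S|$, arrive one by one; neither the future requests nor $n$ is known to the algorithm. The cost of matching request $r$ to server $s$ is the distance $|r-s|$ on the line (edge costs are assumed positive). Each server may be matched to at most one request. The cost $c(M)$ of a matching $M$ is the sum of the costs of its edges. When a request arrives it must immediately be matched, so that after each arrival all requests that have arrived so far are matched. Recourse: upon an arrival, the algorithm may additionally delete a set of edges of its current matching and match the affected, previously arrived requests to different (free) servers; each time the server of a previously arrived request is changed counts as one reassignment. An algorithm is $\alpha$-competitive if on every instance the matching $M$ it computes for all requests of the instance satisfies $c(M)\le \alpha\cdot\mathrm{OPT}$, where $\mathrm{OPT}$ is the minimum cost of a matching that matches all requests of the instance. *)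

(* Defs.v *)
From HB Require Import structures.
From mathcomp Require Import all_boot all_order all_algebra finmap.
From mathcomp Require Import all_classical all_reals all_analysis.

Set Implicit Arguments.
Unset Strict Implicit.
Unset Printing Implicit Defensive.

Import Order.TTheory GRing.Theory Num.Theory.
Local Open Scope ring_scope.

Section LineMatching.
Variable R : realType.

(* An instance is a finite set S of servers together with the sequence rs of
   requests in order of arrival. The requests need not be distinct; since edge
   costs are positive, no request sits on a server. *)
Definition instance (S : {fset R}) (rs : seq R) : Prop :=
  (size rs <= #|` S|)%N /\
  (forall r s, r \in rs -> s \in S -> 0 < `|r - s|).

(* A matching of all requests of rs is the sequence M of their servers: the
   i-th request of rs is matched to the i-th entry of M. *)
Definition is_matching (S : {fset R}) (rs M : seq R) : bool :=
  [&& size M == size rs, uniq M & all (fun s => s \in S) M].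

Definition cost (rs M : seq R) : R :=
  \sum_(i < size rs) `|rs`_i - M`_i|.

(* This infimum is a minimum, see opt_min. *)
Definition opt (S : {fset R}) (rs : seq R) : R :=
  inf [set c : R | exists2 M, is_matching S rs M & c = cost rs M]%classic.

Lemma opt_min (S : {fset R}) (rs : seq R) : (size rs <= #|` S|)%N ->
  (exists2 M, is_matching S rs M & opt S rs = cost rs M) /\
  (forall M, is_matching S rs M -> opt S rs <= cost rs M).
Proof.
move=> leS; pose P (t : (size rs).-tuple S) := is_matching S rs (map val t).
have toP M : is_matching S rs M -> exists2 t, P t & M = map val t.
  case/and3P=> /eqP sM uM /allP MS.
  have eM : map val (pmap insub M : seq S) = M.
    rewrite (pmap_filter (@insubK _ _ _)); apply/all_filterP/allP=> x xM.
    by rewrite isSome_insub MS.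
  have st : size (pmap insub M : seq S) == size rs by rewrite -(size_map val) eM sM.
  exists (Tuple st); last by rewrite /= eM.
  by rewrite /P /= eM /is_matching sM eqxx uM; apply/allP.
have [t0 Pt0 _] : exists2 t, P t & take (size rs) S = map val t.
  apply: toP; apply/and3P; split; first by rewrite size_takel.
    by rewrite take_uniq // fset_uniq.
  by apply/allP=> x /mem_take.
case: (arg_minP (fun t : (size rs).-tuple S => cost rs (map val t)) Pt0) => t Pt mint.
have lbt M : is_matching S rs M -> cost rs (map val t) <= cost rs M.
  by case/toP=> u Pu ->; exact: mint.
have -> : opt S rs = cost rs (map val t).
  apply/eqP; rewrite eq_le; apply/andP; split.
    apply: ge_inf; last by exists (map val t).
    by exists (cost rs (map val t)) => _ [M MP ->]; exact: lbt.
  apply: lb_le_inf; first by exists (cost rs (map val t)), (map val t).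
  by move=> _ [M MP ->]; exact: lbt.
by split=> //; exists (map val t).
Qed.

(* A deterministic online algorithm knows S from the start, and the matching it
   maintains is determined by S and the requests that have arrived so far.
   Recourse is unrestricted here (the matchings of two successive prefixes may
   differ arbitrarily); it is counted by reassignments below. *)
Record online_algorithm := OnlineAlgorithm {
  assign :> {fset R} -> seq R -> seq R;
  assign_matching : forall S rs, instance S rs -> is_matching S rs (assign S rs)
}.

Definition competitive (alpha : R) (A : online_algorithm) : Prop :=
  forall S rs, instance S rs -> cost rs (A S rs) <= alpha * opt S rs.

(* The step t is the arrival of the request of index t; only the requests of
   index i < t arrived previously. *)
Definition step_reassignments (A : online_algorithm) (S : {fset R})
    (rs : seq R) (t : nat) : nat :=
  #|[set i : 'I_t | (A S (take t rs))`_i != (A S (take t.+1 rs))`_i]%SET|.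

Definition reassignments (A : online_algorithm) (S : {fset R}) (rs : seq R) : nat :=
  (\sum_(t < size rs) step_reassignments A S rs t)%N.

End LineMatching.

(* Main.v *)
Require Import Defs.
From HB Require Import structures.
From mathcomp Require Import all_boot all_order all_algebra finmap.
From mathcomp Require Import all_classical all_reals all_analysis.
From mathcomp Require Import ring lra zify.

Set Implicit Arguments.
Unset Strict Implicit.
Unset Printing Implicit Defensive.

Import Order.TTheory GRing.Theory Num.Theory.
Local Open Scope ring_scope.

(* A request r at which the edges already chosen have net flow D goes to the nearest
   free server on the side where a path is cheaper, one more edge costing 1 per unit
   length where it adds to |D| and -rho where it cancels flow, rho = 1/24; when both
   costs are within a factor 1/rho it goes to the nearer server. Then all path costs
   to free servers stay nonnegative, and the distance to the free servers in this
   price is a dual solution showing that the integral of |D|, the cost of an optimal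
   matching to the servers in use, is at most opt/rho at all times.

   The sum of the lengths of the chosen edges is O(opt * log n). Indeed, let the span of
   an arrival be the distance of the two free servers next to it. The arrivals with
   span < L form a run of the same algorithm, so their flow also is O(opt). Among the
   arrivals with span in [L, 3L/2), leftward and rightward edges overlap only by sweeps
   across a whole interval; as these meet mostly opposite flow, they are paid for by the
   flow of the arrivals with span < L. Hence each of these levels contributes O(opt);
   there are O(log n) levels between opt/n and O(opt), the edges below have total length
   at most opt, and those above never overlap in opposite directions.

   Start a new phase whenever opt has doubled, with value B, match new requests to
   their online servers, and rematch the requests of the phase optimally within their
   servers whenever the edges added since the last time have total length more than B.
   The frozen phases cost a geometric sum, and each phase has O(log n) rematchings. *)

Lemma bigD1_seq_cond (V : Type) (idx : V) (op : Monoid.com_law idx)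
    (I : eqType) (s : seq I) (P : pred I) (F : I -> V) j :
  j \in s -> uniq s -> P j ->
  \big[op/idx]_(i <- s | P i) F i =
    op (F j) (\big[op/idx]_(i <- s | P i && (i != j)) F i).
Proof.
move=> js us Pj; rewrite -big_filter (bigD1_seq j) ?filter_uniq ?mem_filter ?Pj //=.
by rewrite big_filter_cond.
Qed.

(** * Integration of step functions over a finite partition *)

Section Partition.
Variable R : realFieldType.
Variable pts : seq R.
Hypothesis pts_uniq : uniq pts.

(* Functions are constant on the cells [x, next_pt x), x in pts; the last cell is empty. *)
Definition next_pt (x : R) : R := head x (sort <=%R [seq y <- pts | x < y]).

Definition width (x : R) : R := next_pt x - x.

Definition integral (a b : R) (f : R -> R) : R :=
  \sum_(x <- pts | a <= x < b) width x * f x.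

Definition total (f : R -> R) : R := \sum_(x <- pts) width x * f x.

Lemma next_ptP (x y : R) : y \in pts -> x < y ->
  [/\ next_pt x \in pts, x < next_pt x & next_pt x <= y].
Proof.
move=> yp xy; rewrite /next_pt.
have : y \in sort <=%R [seq y <- pts | x < y] by rewrite mem_sort mem_filter xy.
have : sorted <=%R (sort <=%R [seq y <- pts | x < y]) by exact/sort_sorted/le_total.
have : all (fun z => (x < z) && (z \in pts)) (sort <=%R [seq y <- pts | x < y]).
  by apply/allP => z; rewrite mem_sort mem_filter.
case: (sort _ _) => [|z s] //= /andP[/andP[xz zp] _] sz; rewrite inE => /orP[/eqP->|ys].
  by split.
by split=> //; have /allP := order_path_min le_trans sz; apply.
Qed.

Lemma next_pt_ge x : x <= next_pt x.
Proof.
rewrite /next_pt.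
have : all (fun z => x < z) (sort <=%R [seq y <- pts | x < y]).
  by apply/allP => z; rewrite mem_sort mem_filter => /andP[].
by case: (sort _ _) => //= z s /andP[/ltW].
Qed.

Lemma width_ge0 x : 0 <= width x.
Proof. by rewrite subr_ge0 next_pt_ge. Qed.

(** The fundamental theorem of calculus on the partition, by induction on the number of points in
    [[a, b)]: the cell of [a] is split off, and the other cells begin at [next_pt a]. *)
Lemma telescope_pts (g : R -> R) (a b : R) : a \in pts -> b \in pts -> a <= b ->
  \sum_(x <- pts | a <= x < b) (g (next_pt x) - g x) = g b - g a.
Proof.
move=> + bp; have [n] := ubnP (count (fun x => a <= x < b) pts).
elim: n a => // n IH a; rewrite ltnS => cn ap; rewrite le_eqVlt => /orP[/eqP<-|ab].
  by rewrite big_pred0 ?subrr // => x; case: leP => //= ax; rewrite ltNge ax.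
have [np an nb] := next_ptP bp ab.
have E x : x \in pts -> (a <= x < b) && (x != a) = (next_pt a <= x < b).
  move=> xp; have [->|xa] := eqVneq x a; first by rewrite andbF leNgt an.
  rewrite andbT; congr (_ && _); apply/idP/idP => [ax|]; last by move/(lt_le_trans an)/ltW.
  by have [] := next_ptP xp (_ : a < x) => //; rewrite lt_neqAle eq_sym xa.
rewrite (bigD1_seq_cond _ _ ap) ?lexx ?ab //.
rewrite big_seq_cond.
rewrite (eq_bigl (fun x => (x \in pts) && (next_pt a <= x < b))); last first.
  by move=> x; case xp: (x \in pts) => //=; rewrite E.
rewrite -big_seq_cond IH //=; first by ring.
apply: leq_trans cn; rewrite -!size_filter.
rewrite -(_ : [seq x <- [seq x <- pts | a <= x < b] | x != a] =
              [seq x <- pts | next_pt a <= x < b]).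
  set t := [seq x <- pts | a <= x < b]; rewrite size_filter ltn_neqAle count_size andbT.
  by rewrite -all_count -has_predC; apply/hasP; exists a; rewrite /= ?mem_filter ?lexx ?ab ?eqxx.
rewrite -filter_predI; apply: eq_in_filter => x xp /=.
by rewrite andbC E.
Qed.

Lemma integral1 a b : a \in pts -> b \in pts -> a <= b ->
  integral a b (fun=> 1) = b - a.
Proof.
move=> ap bp ab; rewrite -(telescope_pts id ap bp ab).
by apply: eq_bigr => x _; rewrite mulr1.
Qed.

Lemma integral_eq a b f g :
  (forall x, x \in pts -> a <= x -> x < b -> f x = g x) ->
  integral a b f = integral a b g.
Proof.
move=> fg; rewrite /integral !(big_seq_cond (fun x => _ <= x < _)).
by apply: eq_bigr => x /and3P[xp ax xb]; rewrite fg.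
Qed.

Lemma le_integral a b f g :
  (forall x, x \in pts -> a <= x -> x < b -> f x <= g x) ->
  integral a b f <= integral a b g.
Proof.
move=> fg; rewrite /integral !(big_seq_cond (fun x => _ <= x < _)).
by apply: ler_sum => x /and3P[xp ax xb]; rewrite ler_wpM2l ?width_ge0 ?fg.
Qed.

Lemma integral_ge0 a b f : (forall x, x \in pts -> a <= x -> x < b -> 0 <= f x) ->
  0 <= integral a b f.
Proof.
move=> f0; rewrite -[X in X <= _](_ : integral a b (fun=> 0) = 0); first exact: le_integral.
by rewrite /integral big1 // => x _; rewrite mulr0.
Qed.

Lemma integralD a b f g :
  integral a b (fun x => f x + g x) = integral a b f + integral a b g.
Proof. by rewrite /integral -big_split; apply: eq_bigr => x _; rewrite mulrDr. Qed.

Lemma integralZ a b c f : integral a b (fun x => c * f x) = c * integral a b f.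
Proof. by rewrite /integral mulr_sumr; apply: eq_bigr => x _; rewrite mulrCA. Qed.

Lemma integral_empty a b f : b <= a -> integral a b f = 0.
Proof.
move=> ba; rewrite /integral big_pred0 // => x.
by apply/negbTE/negP => /andP[ax xb]; move: (le_lt_trans ax xb); rewrite ltNge ba.
Qed.

Lemma integral_cat a b c f : a <= b -> b <= c ->
  integral a c f = integral a b f + integral b c f.
Proof.
move=> ab bc; rewrite /integral (bigID (fun x => x < b)) /=; congr (_ + _).
  apply: eq_bigl => x; case: (ltP x b) => xb; rewrite ?andbF ?andbT //.
  by rewrite (lt_le_trans xb bc) andbT.
apply: eq_bigl => x; case: (ltP x b) => xb; rewrite ?andbF ?andbT //=.
by rewrite (le_trans ab xb).
Qed.

Lemma integral_cell x f : x \in pts ->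
  integral x (next_pt x) f = width x * f x.
Proof.
move=> xp; have [e|xn] := eqVneq (next_pt x) x.
  by rewrite integral_empty ?e // /width e subrr mul0r.
have xlt : x < next_pt x by rewrite lt_neqAle eq_sym xn next_pt_ge.
rewrite /integral (bigD1_seq_cond _ _ xp) ?lexx ?xlt //=.
rewrite big_seq_cond big1 ?addr0 // => y /andP[yp /andP[/andP[xy yn] yx]].
have xy' : x < y by rewrite lt_neqAle eq_sym yx.
by have [_ _] := next_ptP yp xy'; rewrite leNgt yn.
Qed.

Lemma integral_total a b f :
  integral a b f = total (fun x => (a <= x < b)%R%:R * f x).
Proof.
rewrite /integral /total big_mkcond; apply: eq_bigr => x _.
by case: ifP; rewrite ?mul1r ?mul0r ?mulr0.
Qed.

Lemma total_eq f g : {in pts, f =1 g} -> total f = total g.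
Proof. by move=> fg; apply: eq_big_seq => x xp; rewrite fg. Qed.

Lemma le_total_fun f g : (forall x, x \in pts -> f x <= g x) -> total f <= total g.
Proof.
move=> fg; rewrite /total !big_seq; apply: ler_sum => x xp.
by rewrite ler_wpM2l ?width_ge0 ?fg.
Qed.

Lemma totalD f g : total (fun x => f x + g x) = total f + total g.
Proof. by rewrite /total -big_split; apply: eq_bigr => x _; rewrite mulrDr. Qed.

Lemma totalZ c f : total (fun x => c * f x) = c * total f.
Proof. by rewrite /total mulr_sumr; apply: eq_bigr => x _; rewrite mulrCA. Qed.

Lemma total_sum (I : Type) (s : seq I) (P : pred I) (F : I -> R -> R) :
  total (fun x => \sum_(i <- s | P i) F i x) = \sum_(i <- s | P i) total (F i).
Proof.
by rewrite /total exchange_big /=; apply: eq_bigr => x _; rewrite mulr_sumr.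
Qed.

Lemma integral_le_total a b f g : (forall x, x \in pts -> 0 <= g x) ->
  (forall x, x \in pts -> a <= x -> x < b -> f x <= g x) ->
  integral a b f <= total g.
Proof.
move=> g0 fg; rewrite integral_total; apply: le_total_fun => x xp.
by case: andP => [[ax xb]|_]; rewrite ?mul1r ?mul0r ?fg ?g0.
Qed.

End Partition.

(** * The optimal matching of a given set of servers *)

Section SortedMatching.
Variable R : realType.
Implicit Types (q : seq (R * R)) (a b : seq R).

(** The pairs crossing [x] rightwards minus those crossing it leftwards. This depends only on the
    two multisets of end points, not on how they are paired. *)
Definition net q (x : R) : int :=
  \sum_(p <- q) (((p.1 <= x)%R : nat)%:Z - ((p.2 <= x)%R : nat)%:Z).

Definition sorted_cost q : R :=
  cost (sort <=%R (map fst q)) (sort <=%R (map snd q)).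

(** [i_s] is a permutation sorting [a], so [index i i_s] is the rank of the i-th request, and the
    request receives the server of the same rank in [b]. *)
Definition rematch a b : seq R :=
  let i_s := s2val (perm_iota_sort <=%R 0 a) in
  mkseq (fun i => (sort <=%R b)`_(index i i_s)) (size a).

Lemma size_rematch a b : size (rematch a b) = size a.
Proof. by rewrite size_mkseq. Qed.

Lemma nth_sort_perm a b (i_s : seq nat) : size a = size b ->
  perm_eq i_s (iota 0 (size a)) ->
  perm_eq [seq (sort <=%R b)`_(index i i_s) | i <- iota 0 (size a)] b.
Proof.
move=> sab pi; have ui : uniq i_s by rewrite (perm_uniq pi) iota_uniq.
have si : size i_s = size b by rewrite (perm_size pi) size_iota.
rewrite -(permPl (perm_map _ pi)).
suff -> : [seq (sort <=%R b)`_(index i i_s) | i <- i_s] = sort <=%R b.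
  by rewrite perm_sort.
apply: (@eq_from_nth _ 0) => [|j]; rewrite size_map si ?size_sort // => jb.
by rewrite (nth_map 0%N) ?si // index_uniq // si.
Qed.

Lemma perm_rematch a b : size a = size b -> perm_eq (rematch a b) b.
Proof.
by move=> sab; rewrite /rematch; case: perm_iota_sort => i_s pi _ /=; exact: nth_sort_perm.
Qed.

Lemma cost_rematch a b : size a = size b ->
  cost a (rematch a b) = sorted_cost (zip a b).
Proof.
move=> sab; rewrite /sorted_cost -/(unzip1 _) -/(unzip2 _).
rewrite unzip1_zip ?sab // unzip2_zip ?sab //.
rewrite /rematch; case: perm_iota_sort => i_s pi ea /=.
have ui : uniq i_s by rewrite (perm_uniq pi) iota_uniq.
have si : size i_s = size a by rewrite (perm_size pi) size_iota.
rewrite /cost size_sort.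
rewrite -(big_mkord xpredT (fun i => `|a`_i - (mkseq _ _)`_i|)).
rewrite -(big_mkord xpredT (fun i => `|(sort _ a)`_i - (sort _ b)`_i|)).
rewrite /index_iota subn0 -(perm_big _ pi) /=.
rewrite (big_nth 0%N) si /index_iota subn0 !(big_seq_cond xpredT).
apply: eq_bigr => j; rewrite mem_iota add0n andbT => /andP[_ ja].
have ij : nth 0%N i_s j \in iota 0 (size a) by rewrite -(perm_mem pi) mem_nth ?si.
rewrite mem_iota add0n in ij; case/andP: ij => _ ij.
by rewrite nth_mkseq // index_uniq ?si // ea (nth_map 0%N) ?si.
Qed.

Lemma dist_total (pts : seq R) (a b : R) : uniq pts -> a \in pts -> b \in pts ->
  `|a - b| = total pts (fun x => `|(a <= x)%R%:R - (b <= x)%R%:R|).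
Proof.
move=> up; wlog ab : a b / a <= b => [H|] ap bp.
  have [/H->//|/ltW ba] := leP a b; rewrite distrC H //.
  by apply: total_eq => x _; rewrite distrC.
rewrite distrC ger0_norm ?subr_ge0 // -(integral1 up ap bp ab) integral_total.
apply: total_eq => x _; rewrite mulr1.
case: (leP a x) => ax; case: (leP b x) => bx /=;
  rewrite ?subrr ?subr0 ?normr0 ?normr1 //.
by move: (le_lt_trans (le_trans ab bx) ax); rewrite ltxx.
Qed.

(* At a point x the indicators [a_i <= x] and [b_i <= x] of two sorted sequences
   are comparable, always in the same direction. *)
Lemma sorted_indicators a b x : size a = size b -> sorted <=%R a -> sorted <=%R b ->
  \sum_(i < size a) `|(a`_i <= x)%R%:R - (b`_i <= x)%R%:R| =
  `|\sum_(i < size a) ((a`_i <= x)%R%:R - (b`_i <= x)%R%:R)| :> R.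
Proof.
move=> sab sa sb.
have [H|] := boolP [forall i : 'I_(size a), (a`_i <= x) ==> (b`_i <= x)].
  have le i : (a`_(i : 'I_(size a)) <= x)%R%:R <= (b`_i <= x)%R%:R :> R.
    by rewrite ler_nat; move/forallP/(_ i)/implyP: H; case: (a`_i <= x) => // ->.
  rewrite ler0_norm; last by apply: sumr_le0 => i _; rewrite subr_le0.
  by rewrite -sumrN; apply: eq_bigr => i _; rewrite ler0_norm // subr_le0.
rewrite negb_forall => /existsP[i]; rewrite negb_imply => /andP[ai bi].
have le j : (b`_(j : 'I_(size a)) <= x)%R%:R <= (a`_j <= x)%R%:R :> R.
  rewrite ler_nat; case: (leP (b`_j) x) => //= bj; rewrite lt0b.
  have [ij|/ltnW ji] := leqP i j.
    have := sorted_leq_nth le_trans le_refl 0 sb; move=> /(_ i j).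
    rewrite !inE -sab !ltn_ord => /(_ isT isT ij) bij.
    by move: (le_trans bij bj); rewrite (negbTE bi).
  have := sorted_leq_nth le_trans le_refl 0 sa; move=> /(_ j i).
  by rewrite !inE !ltn_ord => /(_ isT isT ji) /le_trans ->.
rewrite ger0_norm; last by apply: sumr_ge0 => j _; rewrite subr_ge0.
by apply: eq_bigr => j _; rewrite ger0_norm // subr_ge0.
Qed.

Lemma netE q x : (net q x)%:~R =
  (count (fun y => y <= x) (map fst q))%:R - (count (fun y => y <= x) (map snd q))%:R :> R.
Proof.
rewrite /net; elim: q => [|p q IH]; rewrite ?big_nil ?subrr // big_cons /= !natrD.
by rewrite rmorphD /= IH rmorphB /=; ring.
Qed.

Lemma sum_indicator a x :
  \sum_(i < size a) (a`_i <= x)%R%:R = (count (fun y => y <= x) a)%:R :> R.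
Proof.
rewrite -(big_mkord xpredT (fun i => (a`_i <= x)%R%:R)).
rewrite -(big_nth 0 xpredT (fun y => (y <= x)%R%:R)) -natr_sum -sum1_count.
by rewrite [in RHS]big_mkcond; congr _%:R; apply: eq_bigr => y _; case: (y <= x).
Qed.

(** By [sorted_indicators] all edges of the monotone matching that cross a point do so in the same
    direction, so nothing cancels when their lengths are summed. This turns an optimal cost into the
    L1 norm of a flow. *)
Lemma sorted_cost_total (pts : seq R) q : uniq pts ->
  (forall p, p \in q -> p.1 \in pts /\ p.2 \in pts) ->
  sorted_cost q = total pts (fun x => `|net q x|%:~R).
Proof.
move=> up qp; rewrite /sorted_cost /cost.
set a := sort _ _; set b := sort _ _.
have sab : size a = size b by rewrite !size_sort !size_map.
have ap i : (i < size a)%N -> a`_i \in pts.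
  move/(mem_nth 0); rewrite mem_sort => /mapP[p /qp[pp _] e].
  by rewrite /a e.
have bp i : (i < size a)%N -> b`_i \in pts.
  rewrite sab; move/(mem_nth 0); rewrite mem_sort => /mapP[p /qp[_ pp] e].
  by rewrite /b e.
rewrite (eq_bigr (fun i : 'I_(size a) =>
  total pts (fun x => `|(a`_i <= x)%R%:R - (b`_i <= x)%R%:R|))); last first.
  by move=> i _; apply: dist_total => //; [exact: ap|exact: bp].
rewrite -total_sum; apply: total_eq => x _.
rewrite sorted_indicators //; try exact/sort_sorted/le_total.
rewrite intr_norm netE; congr `|_|; rewrite sumrB sum_indicator sab sum_indicator.
by rewrite /a /b !count_sort.
Qed.

Lemma net_cat q1 q2 x : net (q1 ++ q2) x = net q1 x + net q2 x.
Proof. by rewrite /net big_cat. Qed.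

Lemma sorted_cost_catl q1 q2 :
  sorted_cost q1 <= sorted_cost (q1 ++ q2) + sorted_cost q2.
Proof.
set pts := undup (map fst (q1 ++ q2) ++ map snd (q1 ++ q2)).
have up : uniq pts by exact: undup_uniq.
have qp p : p \in q1 ++ q2 -> p.1 \in pts /\ p.2 \in pts.
  move=> pq; rewrite !mem_undup !mem_cat; split; apply/orP; [left|right]; exact: map_f.
rewrite !(@sorted_cost_total pts) //; last first.
- by move=> p pq; apply: qp; rewrite mem_cat pq ?orbT.
- by move=> p pq; apply: qp; rewrite mem_cat pq ?orbT.
rewrite -totalD; apply: le_total_fun => // x _; rewrite net_cat -rmorphD /= ler_int.
by rewrite -[net q1 x in X in X <= _](addrK (net q2 x)) ler_normB.
Qed.

Lemma sorted_cost_perm q1 q2 : perm_eq q1 q2 -> sorted_cost q1 = sorted_cost q2.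
Proof.
move=> pq; rewrite /sorted_cost.
have E (f : R * R -> R) : sort <=%R (map f q1) = sort <=%R (map f q2).
  by apply/perm_sortP; [exact: le_total|exact: le_trans|exact: le_anti|exact: perm_map].
by rewrite !E.
Qed.

End SortedMatching.

(** * Greedy runs and their invariant *)

Section Runs.
Variable R : realType.
Implicit Types (T : seq R).

(* A request, the free servers next to it on its left and on its right at its
   arrival, and whether it takes the left one. Histories are lists of entries,
   newest first. *)
Definition entry : eqType := (R * (R * R) * bool)%type.
Implicit Types (e : entry) (h : seq entry).

Definition request e := e.1.1.
Definition left_free e := e.1.2.1.
Definition right_free e := e.1.2.2.
Definition goes_left e := e.2.
Definition server e := if goes_left e then left_free e else right_free e.
Definition edge e := (request e, server e).
Definition span e := right_free e - left_free e.
Definition edge_len e := `|request e - server e|.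

(* Positive when more edges cross x rightwards than leftwards. *)
Definition flow h (x : R) : int := net (map edge h) x.

Definition rho : R := 24%:R^-1.
(* The price per unit length of one more edge going left where the flow is d:
   cancelling an edge that goes right is rewarded, but at a lower rate. *)
Definition left_rate (d : int) : R := if d <= 0 then 1 else - rho.
Definition right_rate (d : int) : R := if 0 <= d then 1 else - rho.

Definition free T h := [seq s <- T | s \notin map server h].

(** [XL] and [XR] are path costs, [dl] and [dr] distances. The first condition keeps path costs
    nonnegative; the second forces an edge to the farther server to run mostly against the flow. *)
Definition toward_left (XL XR dl dr : R) :=
  rho * XL <= XR /\ (dl <= dr \/ XL < rho * XR).

Definition choice_ok (left : bool) (XL XR dl dr : R) :=
  if left then toward_left XL XR dl dr else toward_left XR XL dr dl.

Variable pts : seq R.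
Hypothesis pts_uniq : uniq pts.

Local Notation integral := (integral pts).
Local Notation total := (total pts).

Definition left_cost h a b := integral a b (fun x => left_rate (flow h x)).
Definition right_cost h a b := integral a b (fun x => right_rate (flow h x)).

Definition between e := left_free e < request e < right_free e.

Definition step_ok T h e : Prop :=
  [/\ left_free e \in free T h /\ right_free e \in free T h,
      between e /\ request e \in pts,
      forall s, s \in free T h -> s <= left_free e \/ right_free e <= s &
      choice_ok (goes_left e)
        (left_cost h (left_free e) (request e))
        (right_cost h (request e) (right_free e))
        (request e - left_free e) (right_free e - request e)].

Fixpoint valid T h : Prop :=
  if h is e :: h' then step_ok T h' e /\ valid T h' else True.

Variable T : seq R.
Hypothesis T_uniq : uniq T.
Hypothesis T_pts : {subset T <= pts}.

Lemma rho_gt0 : 0 < rho. Proof. by rewrite /rho; lra. Qed.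

Lemma left_rate_le d d' : d' <= d -> left_rate d <= left_rate d'.
Proof.
rewrite /left_rate /rho => dd; case: ifP => d0; first by rewrite (le_trans dd d0).
by case: ifP => _; lra.
Qed.

Lemma right_rate_le d d' : d <= d' -> right_rate d <= right_rate d'.
Proof.
rewrite /right_rate /rho => dd; case: ifP => d0; first by rewrite (le_trans d0 dd).
by case: ifP => _; lra.
Qed.

(** A leftward edge turns the flow [d] into [d - 1]. Where this makes the rightward rate [-rho],
    that is for [d <= 0], the edge itself was charged the full rate 1. *)
Lemma right_rate_move d : 0 <= right_rate (d - 1) + rho * left_rate d.
Proof.
rewrite /right_rate /left_rate /rho subr_ge0 -gtz0_ge1 ltNge.
by case: (d <= 0) => /=; lra.
Qed.

Lemma left_rate_move d : 0 <= left_rate (d + 1) + rho * right_rate d.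
Proof.
rewrite /right_rate /left_rate /rho -ltzD1 ltrD2r ltNge.
by case: (0 <= d) => /=; lra.
Qed.

Lemma flow_cons e h x : flow (e :: h) x = flow [:: e] x + flow h x.
Proof. by rewrite /flow /net /= !big_cons big_nil addr0. Qed.

Lemma flow_nil x : flow [::] x = 0. Proof. by rewrite /flow /net big_nil. Qed.

Lemma flow1E e x : between e -> flow [:: e] x =
  if goes_left e then - ((left_free e <= x < request e)%R : nat)%:Z
  else ((request e <= x < right_free e)%R : nat)%:Z.
Proof.
rewrite /between /flow /net /= big_seq1 /= /server => /andP[lr rr].
by case: (goes_left e); [case: (leP (left_free e) x)|case: (leP (right_free e) x)];
  case: (leP (request e) x) => a b //=; exfalso; lra.
Qed.

Lemma flow_below e h y : y < request e -> y < server e -> flow (e :: h) y = flow h y.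
Proof. by move=> yr ys; rewrite /flow /net /= big_cons /= !leNgt yr ys add0r. Qed.

Lemma flow_above e h y : request e <= y -> server e <= y -> flow (e :: h) y = flow h y.
Proof. by move=> yr ys; rewrite /flow /net /= big_cons /= yr ys add0r. Qed.

Lemma integral_below (g : int -> R) e h a b : b <= request e -> b <= server e ->
  integral a b (fun x => g (flow (e :: h) x)) = integral a b (fun x => g (flow h x)).
Proof.
move=> br bs; apply: integral_eq => y _ _ yb.
by rewrite flow_below // (lt_le_trans yb).
Qed.

Lemma integral_above (g : int -> R) e h a b : request e <= a -> server e <= a ->
  integral a b (fun x => g (flow (e :: h) x)) = integral a b (fun x => g (flow h x)).
Proof.
move=> ra sa; apply: integral_eq => y _ ay _.
by rewrite flow_above // (le_trans _ ay).
Qed.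

Lemma free_cons h e s : (s \in free T (e :: h)) = (s != server e) && (s \in free T h).
Proof. by rewrite !mem_filter /= inE negb_or -andbA. Qed.

Lemma free_sub h s : s \in free T h -> s \in T.
Proof. by rewrite mem_filter => /andP[]. Qed.

Lemma server_cases e : server e = left_free e \/ server e = right_free e.
Proof. by rewrite /server; case: ifP; [left|right]. Qed.

Lemma step_server h e : step_ok T h e -> server e \in free T h.
Proof. by case=> -[l r] _ _ _; rewrite /server; case: ifP. Qed.

Lemma valid_between h e : valid T h -> e \in h -> between e.
Proof.
elim: h => // e' h IH [[_ [b _] _ _] v]; rewrite inE => /orP[/eqP->//|]; exact: IH.
Qed.

Lemma valid_cat h1 h2 : valid T (h1 ++ h2) -> valid T h2.
Proof. by elim: h1 => //= e h1 IH [_ /IH]. Qed.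

Lemma request_pts h e : valid T h -> e \in h -> request e \in pts.
Proof.
elim: h => // e' h IH [[_ [_ b] _ _] v]; rewrite inE => /orP[/eqP->//|]; exact: IH.
Qed.

Lemma ends_T h e : valid T h -> e \in h -> left_free e \in T /\ right_free e \in T.
Proof.
elim: h => // e' h IH [[[a b] _ _ _] v]; rewrite inE => /orP[/eqP->//|]; last exact: IH.
by split; apply: free_sub; eassumption.
Qed.

Lemma free_outside h e s : valid T h -> e \in h -> s \in free T h ->
  s <= left_free e \/ right_free e <= s.
Proof.
elim: h => // e' h IH [[_ _ st _] v]; rewrite inE free_cons => eh /andP[_ sf].
by case/orP: eh => [/eqP->|/IH]; auto.
Qed.

Lemma used_uniq h : valid T h -> uniq (map server h) /\ {subset map server h <= T}.
Proof.
elim: h => // e h IH [st /IH[u sub]] /=; have := step_server st.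
rewrite mem_filter => /andP[-> sT]; split=> // s; rewrite inE => /orP[/eqP->//|]; exact: sub.
Qed.

(* The rule keeps every path cost nonnegative; the inequalities behind this
   are right_rate_move and left_rate_move. *)
Definition nonneg_costs h : Prop := forall u x, u \in free T h -> x \in pts ->
  (u <= x -> 0 <= left_cost h u x) /\ (x <= u -> 0 <= right_cost h x u).

Lemma valid_nonneg h : valid T h -> nonneg_costs h.
Proof.
elim: h => [_ u x _ _|e h IH [[[lF rF] [bt rp] st ch] v]].
  split=> _; apply: integral_ge0 => // y _ _ _;
  by rewrite /left_rate /right_rate flow_nil lexx.
move: IH => /(_ v) IH u x; rewrite free_cons => /andP[us uF] xp.
have lT := T_pts (free_sub lF); have rT := T_pts (free_sub rF).
have uT := T_pts (free_sub uF).
have := bt; rewrite /between => /andP[lr rr].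
move: us ch; rewrite /choice_ok /toward_left.
case dir: (goes_left e) => us [ch _]; split=> ux.
- apply: le_trans (proj1 (IH u x uF xp) ux) _; apply: le_integral => // y _ _ _.
  by apply: left_rate_le; rewrite flow_cons flow1E // dir gerDr oppr_le0.
- have sE : server e = left_free e by rewrite /server dir.
  have slr : server e <= request e by rewrite sE ltW.
  rewrite sE in us.
  have [ul|ru] := st u uF.
    by rewrite /right_cost integral_below ?sE ?(le_trans ul (ltW lr)) //; apply: (IH u x uF xp).2.
  have [rx|xr] := leP (request e) x.
    by rewrite /right_cost integral_above ?(le_trans slr) //; apply: (IH u x uF xp).2.
  (* Only on [[x1, request e]] does the new edge lower the price. By [right_rate_move] the price
     there is at least [-rho] times the old left cost of that stretch, hence at least [-rho] times
     the whole left cost of [e]. The choice makes the right cost of [e], which the path also pays,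
     large enough to compensate. *)
  set x1 := Num.max x (left_free e).
  have x1p : x1 \in pts by rewrite /x1; case: leP.
  have xx1 : x <= x1 by rewrite le_max lexx.
  have lx1 : left_free e <= x1 by rewrite le_max lexx orbT.
  have x1r : x1 <= request e by rewrite ge_max !ltW.
  have ru' := lt_le_trans rr ru.
  rewrite /right_cost (integral_cat _ _ xx1 (le_trans x1r (ltW ru'))).
  rewrite (integral_cat _ _ x1r (ltW ru')) (integral_cat _ _ (ltW rr) ru).
  have B : right_cost (e :: h) (request e) (right_free e) =
           right_cost h (request e) (right_free e) by exact: integral_above.
  have C : right_cost (e :: h) (right_free e) u = right_cost h (right_free e) u.
    by rewrite /right_cost integral_above ?(le_trans slr) // ltW.
  have A : 0 <= integral x x1 (fun y => right_rate (flow (e :: h) y)).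
    rewrite /x1; case: (leP x (left_free e)) => [xl|_]; last by rewrite integral_empty.
    by rewrite integral_below ?sE ?lexx ?(ltW lr) //; apply: (IH _ x lF xp).2.
  have C' := (IH u _ uF rT).2 ru.
  have E : 0 <= integral x1 (request e) (fun y => right_rate (flow (e :: h) y)) +
           rho * integral x1 (request e) (fun y => left_rate (flow h y)).
    rewrite -integralZ -integralD; apply: integral_ge0 => // y _ xy yr.
    by rewrite flow_cons flow1E // dir (le_trans lx1 xy) yr /= [_ + flow h y]addrC right_rate_move.
  have F := (IH _ _ lF x1p).1 lx1.
  move: ch; rewrite /left_cost (integral_cat _ _ lx1 x1r) mulrDr -/(left_cost _ _ _).
  have : 0 <= rho * left_cost h (left_free e) x1 by rewrite mulr_ge0 // ltW ?rho_gt0.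
  by move: B C C'; rewrite /right_cost; lra.
- have sE : server e = right_free e by rewrite /server dir.
  have slr : request e <= server e by rewrite sE ltW.
  rewrite sE in us.
  have [ul|ru] := st u uF; last first.
    by rewrite /left_cost integral_above ?sE ?(le_trans (ltW rr) ru) //; apply: (IH u x uF xp).1.
  have [xr|rx] := leP x (request e).
    by rewrite /left_cost integral_below ?(le_trans _ slr) //; apply: (IH u x uF xp).1.
  set x1 := Num.min x (right_free e).
  have x1p : x1 \in pts by rewrite /x1; case: leP.
  have xx1 : x1 <= x by rewrite ge_min lexx.
  have lx1 : x1 <= right_free e by rewrite ge_min lexx orbT.
  have x1r : request e <= x1 by rewrite le_min !ltW.
  have ru' := le_lt_trans ul lr.
  rewrite /left_cost (integral_cat _ _ (le_trans (ltW ru') x1r) xx1).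
  rewrite (integral_cat _ _ (ltW ru') x1r) (integral_cat _ _ ul (ltW lr)).
  have B : left_cost (e :: h) (left_free e) (request e) =
           left_cost h (left_free e) (request e) by exact: integral_below.
  have C : left_cost (e :: h) u (left_free e) = left_cost h u (left_free e).
    by rewrite /left_cost integral_below ?(le_trans _ slr) // ltW.
  have A : 0 <= integral x1 x (fun y => left_rate (flow (e :: h) y)).
    rewrite /x1; case: (leP x (right_free e)) => [_|xl]; first by rewrite integral_empty.
    by rewrite integral_above ?sE ?lexx ?(ltW rr) //; apply: (IH _ x rF xp).1; rewrite ltW.
  have C' := (IH u _ uF lT).1 ul.
  have E : 0 <= integral (request e) x1 (fun y => left_rate (flow (e :: h) y)) +
           rho * integral (request e) x1 (fun y => right_rate (flow h y)).
    rewrite -integralZ -integralD; apply: integral_ge0 => // y _ xy yr.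
    by rewrite flow_cons flow1E // dir xy (lt_le_trans yr lx1) /= [_ + flow h y]addrC left_rate_move.
  have F := (IH _ _ rF x1p).2 lx1.
  have : 0 <= rho * right_cost h x1 (right_free e) by rewrite mulr_ge0 // ltW ?rho_gt0.
  move: ch; rewrite {1}/right_cost (integral_cat _ _ x1r lx1) mulrDr.
  by move: A B C C'; rewrite /left_cost /right_cost; lra.
- apply: le_trans (proj2 (IH u x uF xp) ux) _; apply: le_integral => // y _ _ _.
  by apply: right_rate_le; rewrite flow_cons flow1E // dir lerDr.
Qed.

End Runs.

(** * Constant competitiveness by a dual solution *)

Section Competitive.
Variable R : realType.
Implicit Types (e : entry R) (h : seq (entry R)).
Variables (pts T : seq R).
Hypothesis pts_uniq : uniq pts.
Hypothesis T_uniq : uniq T.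
Hypothesis T_pts : {subset T <= pts}.

Local Notation integral := (integral pts).
Local Notation total := (total pts).
Local Notation next_pt := (next_pt pts).
Local Notation width := (width pts).
Local Notation valid := (valid pts T).
Local Notation left_cost := (left_cost pts).
Local Notation right_cost := (right_cost pts).
Local Notation rho := (rho R).

(* Y is a feasible solution of the dual of the minimum cost matching problem. *)
Definition dual_bound (O : R) h := forall Y : R -> R,
  (forall x, x \in pts -> 0 <= Y x) ->
  (forall x, x \in pts -> `|Y (next_pt x) - Y x| <= width x) ->
  \sum_(e <- h) Y (request e) - \sum_(s <- T) Y s <= O.

(** As [Y] is nonnegative, forgetting requests only lowers the dual value, so restricted runs obey
    the bound with the same [O]. *)
Lemma dual_bound_filter O h (P : pred (entry R)) : valid h ->
  dual_bound O h -> dual_bound O [seq e <- h | P e].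
Proof.
move=> v H Y Y0 YL; apply: le_trans (H Y Y0 YL); rewrite lerD2r.
rewrite big_filter [X in _ <= X](bigID P) /= lerDl big_seq_cond.
by apply: sumr_ge0 => e /andP[eh _]; apply: Y0; exact: request_pts v eh.
Qed.

Lemma dual_bound_cat O h1 h2 : valid (h1 ++ h2) ->
  dual_bound O (h1 ++ h2) -> dual_bound O h2.
Proof.
move=> v H Y Y0 YL; apply: le_trans (H Y Y0 YL); rewrite lerD2r.
rewrite big_cat /= lerDr big_seq_cond; apply: sumr_ge0 => e /andP[eh _].
by apply: Y0; apply: request_pts v _; rewrite mem_cat eh.
Qed.

Lemma seq_argmin (f : R -> R) (s : seq R) : s != [::] ->
  exists2 u, u \in s & forall v, v \in s -> f u <= f v.
Proof.
elim: s => // a [|b s] IH _.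
  by exists a => [|v]; rewrite inE // => /eqP->.
have [u us um] := IH isT; have [au|ua] := leP (f a) (f u).
  exists a; first by rewrite inE eqxx.
  by move=> v; rewrite inE => /orP[/eqP->//|/um/(le_trans au)].
exists u; first by rewrite inE us orbT.
by move=> v; rewrite inE => /orP[/eqP->|/um//]; rewrite ltW.
Qed.

(* The distance of x to the free servers in the price of one more edge is 1-Lipschitz
   and its slope opposes the flow, so it is a dual solution of value at least
   rho times the total flow. *)
Definition path_cost h u x := if u <= x then left_cost h u x else right_cost h x u.

(** Summation by parts: [telescope_pts] spreads each edge over its cells, and a cell collects with
    sign the edges across it, which is the flow. *)
Lemma sum_edge_telescope (Y : R -> R) h : valid h ->
  \sum_(e <- h) (Y (request e) - Y (server e)) =
  \sum_(x <- pts) (flow h x)%:~R * (Y x - Y (next_pt x)).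
Proof.
elim: h => [_|e h IH /= [st v]].
  by rewrite big_nil big1 // => x _; rewrite flow_nil mul0r.
rewrite big_cons IH //; have [[lF rF] [bt rp] _ _] := st.
rewrite [RHS](eq_bigr (fun x => (flow [:: e] x)%:~R * (Y x - Y (next_pt x)) +
  (flow h x)%:~R * (Y x - Y (next_pt x)))); last first.
  by move=> x _; rewrite (flow_cons e h) rmorphD /= mulrDl.
rewrite big_split /=; congr (_ + _).
have lT := T_pts (free_sub lF); have rT := T_pts (free_sub rF).
have /andP[/ltW lr /ltW rr] := bt.
rewrite /server; case dir: (goes_left e).
  rewrite -(telescope_pts pts_uniq Y lT rp lr) big_mkcond.
  apply: eq_bigr => x _; rewrite flow1E // dir.
  by case: (_ <= x < _)%R => /=; rewrite ?mulN1r ?mul0r ?opprB // oppr0 mul0r.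
rewrite -[LHS]opprB -(telescope_pts pts_uniq Y rp rT rr) big_mkcond -sumrN.
apply: eq_bigr => x _; rewrite flow1E // dir.
by case: (_ <= x < _)%R => /=; rewrite ?mul1r ?mul0r ?opprB // oppr0.
Qed.

Section Potential.
Variables (h : seq (entry R)) (Y : R -> R).
Hypothesis h_valid : valid h.
Hypothesis Y_min : forall x, (exists2 u, u \in free T h & Y x = path_cost h u x) /\
  forall u, u \in free T h -> Y x <= path_cost h u x.

Lemma potential_ge0 x : x \in pts -> 0 <= Y x.
Proof.
move=> xp; have [[u uF ->] _] := Y_min x; rewrite /path_cost.
have [A B] := valid_nonneg T_pts h_valid uF xp.
by case: (leP u x) => [|/ltW]; [exact: A|exact: B].
Qed.

Lemma potential_free s : s \in free T h -> Y s = 0.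
Proof.
move=> sF; apply/eqP; rewrite eq_le potential_ge0 ?T_pts ?(free_sub sF) // andbT.
by have [_ /(_ s sF)] := Y_min s; rewrite /path_cost lexx /left_cost integral_empty.
Qed.

Lemma path_cost_right u x : u \in pts -> x \in pts -> u <= x ->
  path_cost h u (next_pt x) = path_cost h u x + width x * left_rate R (flow h x).
Proof.
move=> up xp ux; have xn := next_pt_ge pts x.
rewrite /path_cost ux (le_trans ux xn) /left_cost (integral_cat _ _ ux xn).
by rewrite (integral_cell pts_uniq).
Qed.

Lemma path_cost_left u x : u \in pts -> x \in pts -> x < u ->
  path_cost h u x = width x * right_rate R (flow h x) + path_cost h u (next_pt x).
Proof.
move=> up xp xu; have [np xn nu] := next_ptP up xu.
rewrite /path_cost (leNgt u x) xu /= /right_cost (integral_cat _ _ (ltW xn) nu).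
rewrite (integral_cell pts_uniq) //; case: ltgtP nu => // e _.
by rewrite e /left_cost !integral_empty.
Qed.

Lemma potential_slope x : x \in pts ->
  [/\ `|Y (next_pt x) - Y x| <= width x,
      0 < flow h x -> Y (next_pt x) <= Y x - rho * width x &
      flow h x < 0 -> Y x <= Y (next_pt x) - rho * width x].
Proof.
move=> xp; have w0 := width_ge0 pts x; set w := width x in w0 *.
have up u : u \in free T h -> u \in pts by move/free_sub/T_pts.
have [[u uF eu] mu] := Y_min x; have [[t tF et] mt] := Y_min (next_pt x).
have [uq tq] := (up u uF, up t tF).
(* A cheapest path to [x] becomes a candidate at [next_pt x] when it is prolonged by the cell of
   [x], if it comes from the left, or shortened by it, if it comes from the right. [B] is the
   converse. *)
have A : Y (next_pt x) <= Y x + w * left_rate R (flow h x) \/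
         Y (next_pt x) <= Y x - w * right_rate R (flow h x).
  have := mt u uF; have [ux|xu] := leP u x.
    by rewrite path_cost_right // -eu; left.
  by rewrite eu (path_cost_left _ _ xu) // -/w; right; lra.
have B : Y x <= Y (next_pt x) - w * left_rate R (flow h x) \/
         Y x <= Y (next_pt x) + w * right_rate R (flow h x).
  have := mu t tF; have [tx|xt] := leP t x.
    by rewrite et path_cost_right // -/w; left; lra.
  by rewrite (path_cost_left _ _ xt) // -et; right; rewrite addrC.
move: A B; rewrite /left_rate /right_rate /rho.
by case: (ltgtP (flow h x) 0) => _ /= A B; split=> // *; rewrite ?ler_norml;
  try (apply/andP; split); case: A => A; case: B => B; lra.
Qed.

End Potential.

(** Let [Y] be the distance to the free servers in the price. It vanishes at servers still free, so
    by summation by parts its dual value is the sum of [flow h x * (Y x - Y (next_pt x))]. By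
    [potential_slope] each term is at least [rho] times the width times the absolute flow. *)
Theorem flow_le_dual O h : valid h -> dual_bound O h ->
  rho * total (fun x => `|flow h x|%:~R) <= O.
Proof.
case: h => [|e0 h0] v db.
  rewrite (_ : total _ = 0) ?mulr0; last first.
    by rewrite /total big1 // => x _; rewrite flow_nil normr0 mulr0.
  have H x : x \in pts -> `|0 - 0 : R| <= width x by rewrite subrr normr0 width_ge0.
  by have := db (fun=> 0) (fun _ _ => lexx 0) H; rewrite big_nil big1 // subr0.
set h := e0 :: h0 in v db *.
(* [Y] is a minimum over free servers, so one must exist: of the two neighbours of the newest
   request, one stays free. *)
have Fn : free T h != [::].
  have [[lF rF] [bt _] _ _] := v.1; have /andP[lr rr] := bt.
  have [s] : exists s, s \in free T h.
    case dir: (goes_left e0); [exists (right_free e0)|exists (left_free e0)];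
      rewrite free_cons ?lF ?rF andbT /server dir ?(lt_eqF (lt_trans lr rr)) //.
    by rewrite (gt_eqF (lt_trans lr rr)).
  by case: (free T h).
have ex x : exists y, (exists2 u, u \in free T h & y = path_cost h u x) /\
    forall u, u \in free T h -> y <= path_cost h u x.
  have [u uF um] := seq_argmin (fun u => path_cost h u x) Fn.
  by exists (path_cost h u x); split=> //; exists u.
have [Y Ym] := choice ex.
have sl := potential_slope Ym.
have := db Y (potential_ge0 v Ym) (fun x xp => let: And3 a _ _ := sl x xp in a).
apply: le_trans.
have [uu uT] := used_uniq v.
have -> : \sum_(s <- T) Y s = \sum_(e <- h) Y (server e).
  rewrite -(big_map (@server R) xpredT Y) (bigID (fun s => s \in map (@server R) h)) /=.
  rewrite [X in _ + X]big_seq_cond [X in _ + X]big1 ?addr0; last first.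
    by move=> s /andP[sT sh]; apply: (potential_free v Ym); rewrite mem_filter sh.
  rewrite -big_filter; apply: perm_big; apply: uniq_perm; rewrite ?filter_uniq // => s.
  by rewrite mem_filter; case: (boolP (s \in map (@server R) h)) => //= /uT.
rewrite -sumrB sum_edge_telescope // -totalZ /total big_seq [X in _ <= X]big_seq.
apply: ler_sum => x xp; have [_ sp sn] := sl x xp.
have [d|d|d] := ltgtP (flow h x) 0.
- rewrite (ltr0_norm d) rmorphN /=.
  have A := sn d; rewrite -subr_ge0 in A.
  have D : 0 <= - (flow h x)%:~R :> R by rewrite oppr_ge0 lerz0 ltW.
  have := mulr_ge0 D A; lra.
- rewrite (gtr0_norm d).
  have A := sp d; rewrite -subr_ge0 in A.
  have D : 0 <= (flow h x)%:~R :> R by rewrite ler0z ltW.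
  have := mulr_ge0 D A; lra.
- by rewrite d normr0 !mulr0 mul0r.
Qed.

End Competitive.

(** * Intervals of entries *)

Section Intervals.
Variable R : realType.
Implicit Types (e : entry R) (h : seq (entry R)).
Variables (pts T : seq R).
Hypothesis pts_uniq : uniq pts.
Hypothesis T_uniq : uniq T.
Hypothesis T_pts : {subset T <= pts}.

Local Notation integral := (integral pts).
Local Notation total := (total pts).
Local Notation valid := (valid pts T).
Local Notation rho := (rho R).
Local Notation dual_bound := (dual_bound pts T).

Definition covers e x := left_free e <= x < right_free e.

Lemma flow_sum h x : flow h x = \sum_(e <- h) flow [:: e] x.
Proof.
elim: h => [|e h IH]; first by rewrite flow_nil big_nil.
by rewrite (flow_cons e h) big_cons IH.
Qed.

Lemma flow1_out e x : between e -> ~~ covers e x -> flow [:: e] x = 0.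
Proof.
rewrite /between /covers negb_and -ltNge -leNgt => /andP[lr rr] /orP[xl|rx].
  rewrite flow_below ?flow_nil ?(lt_trans xl lr) //.
  by case: (server_cases e) => ->; rewrite // (lt_trans xl (lt_trans lr rr)).
rewrite flow_above ?flow_nil ?(le_trans (ltW rr) rx) //.
by case: (server_cases e) => ->; rewrite // (le_trans (ltW (lt_trans lr rr)) rx).
Qed.

Lemma flow_filter_cat h (P : pred (entry R)) x :
  flow h x = flow [seq e <- h | P e] x + \sum_(e <- h | ~~ P e) flow [:: e] x.
Proof. by rewrite flow_sum (bigID P) /= -big_filter -flow_sum. Qed.

Lemma flow_filter h (P : pred (entry R)) x : valid h ->
  (forall e, e \in h -> covers e x -> P e) -> flow [seq e <- h | P e] x = flow h x.
Proof.
move=> v hP; rewrite (flow_filter_cat h P) big_seq_cond big1 ?addr0 // => e /andP[eh Pe].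
apply: flow1_out; first exact: valid_between v eh.
by apply: contra Pe; exact: hP.
Qed.

(** The ends of the newer interval are free at its arrival, and by [free_outside] no free server
    lies strictly inside an older interval. Hence the intervals form a laminar family. *)
Lemma newer_contains e h e' : valid (e :: h) -> e' \in h ->
  left_free e < right_free e' -> left_free e' < right_free e ->
  left_free e <= left_free e' /\ right_free e' <= right_free e.
Proof.
move=> [[[lF rF] _ _ _] v] eh lr rl; split.
  by have [//|] := free_outside v eh lF; rewrite leNgt lr.
by have [|//] := free_outside v eh rF; rewrite leNgt rl.
Qed.

Lemma nested h e e' : valid h -> e \in h -> e' \in h ->
  left_free e < right_free e' -> left_free e' < right_free e ->
  (left_free e <= left_free e' /\ right_free e' <= right_free e) \/
  (left_free e' <= left_free e /\ right_free e <= right_free e').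
Proof.
elim: h => // f h IH v; rewrite !inE => /orP[/eqP->|eh] /orP[/eqP->|eh'] lr rl.
- by left.
- by left; exact: newer_contains v eh' lr rl.
- by right; exact: newer_contains v eh rl lr.
- exact: IH v.2 eh eh' lr rl.
Qed.

(* Inside the interval of an arrival of small span, only arrivals of small span
   have left a trace, so they form a run of the same algorithm. *)
Lemma valid_filter_span h L : valid h -> valid [seq e <- h | span e < L].
Proof.
elim: h => // e h IH v; have [st vh] := v; have vf := IH vh.
rewrite /=; case: ifP => // sL; split=> //.
have sub s : s \in free T h -> s \in free T [seq e <- h | span e < L].
  rewrite !mem_filter => /andP[sh ->]; rewrite andbT; apply: contra sh.
  by case/mapP=> f; rewrite mem_filter => /andP[_ fh] ->; exact: map_f.
have small f : f \in h -> left_free e < right_free f -> left_free f < right_free e ->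
    span f < L.
  move=> fh lr rl; have [a b] := newer_contains v fh lr rl.
  by apply: le_lt_trans sL; rewrite /span lerB.
have agree x : left_free e <= x -> x < right_free e ->
    flow [seq e <- h | span e < L] x = flow h x.
  move=> lx xr; apply: flow_filter => // f fh /andP[a b].
  by apply: small => //; [exact: le_lt_trans b|exact: le_lt_trans xr].
have [[lF rF] [bt rp] near ch] := st; have /andP[lr rr] := bt.
split=> //; first by split; exact: sub.
  move=> s; rewrite mem_filter => /andP[sf sT].
  (* A server strictly inside the interval of [e] that the full run has used was used by an arrival
     of small span, so it is not free in the restricted run either. *)
  have [sh|] := boolP (s \in map (@server R) h); last by move=> sh; apply: near; rewrite mem_filter sh.
  have [//|ls] := leP s (left_free e); first by left.
  have [//|sr] := leP (right_free e) s; first by right.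
  case/mapP: sh => f fh sE; case/mapP: sf; exists f => //; rewrite mem_filter fh andbT.
  have /andP[lf rf] := valid_between vh fh.
  have lrf := lt_trans lf rf.
  apply: small => //; case: (server_cases f) => E; rewrite E in sE; rewrite -?sE //.
    by rewrite (lt_trans ls) // sE.
  by rewrite (lt_trans _ sr) // sE.
move: ch; rewrite /left_cost /right_cost.
rewrite (integral_eq (g := fun x => left_rate R (flow [seq e <- h | span e < L] x))); last first.
  by move=> x _ lx xr; rewrite agree // (lt_trans xr).
rewrite [X in choice_ok _ _ X _ _](integral_eq
   (g := fun x => right_rate R (flow [seq e <- h | span e < L] x))) //.
by move=> x _ lx xr; rewrite agree // (le_trans (ltW lr)).
Qed.

Lemma total_norm_flow_filter h (P : pred (entry R)) :
  total (fun x => `|\sum_(e <- h | ~~ P e) flow [:: e] x|%:~R) <=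
  total (fun x => `|flow h x|%:~R) + total (fun x => `|flow [seq e <- h | P e] x|%:~R).
Proof.
rewrite -totalD; apply: le_total_fun => x _; rewrite -rmorphD /= ler_int.
rewrite (flow_filter_cat h P); set a := flow _ _; set b := \sum_(_ <- _ | _) _.
by rewrite -[b in X in X <= _](addrK a) [b + a]addrC ler_normB.
Qed.

Lemma edge_len_total h e : valid h -> e \in h ->
  edge_len e = total (fun x => `|flow [:: e] x|%:~R).
Proof.
move=> v eh; have bt := valid_between v eh; have rp := request_pts v eh.
have /andP[/ltW lr /ltW rr] := bt.
have [/T_pts lT /T_pts rT] := ends_T v eh.
rewrite /edge_len /server; case dir: (goes_left e).
  rewrite ger0_norm ?subr_ge0 // -(integral1 pts_uniq lT rp lr) integral_total.
  apply: total_eq => x _; rewrite flow1E // dir.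
  by case: (_ <= x < _)%R; rewrite /= ?mulr1 ?mul0r.
rewrite distrC ger0_norm ?subr_ge0 // -(integral1 pts_uniq rp rT rr) integral_total.
apply: total_eq => x _; rewrite flow1E // dir.
by case: (_ <= x < _)%R; rewrite /= ?mulr1 ?mul0r.
Qed.

End Intervals.

(** * The length of a single edge, and arrivals with very large spans *)

Section LongEdges.
Variable R : realType.
Implicit Types (e : entry R) (h : seq (entry R)).
Variables (pts T : seq R).
Hypothesis pts_uniq : uniq pts.
Hypothesis T_uniq : uniq T.
Hypothesis T_pts : {subset T <= pts}.

Local Notation integral := (integral pts).
Local Notation total := (total pts).
Local Notation valid := (valid pts T).
Local Notation rho := (rho R).
Local Notation dual_bound := (dual_bound pts T).

Lemma left_rate_after (d : int) : left_rate R d + rho <= (1 + rho) * `|d - 1|%:~R.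
Proof.
rewrite /left_rate /rho; case: ifP => d0; last first.
  by rewrite addNr mulr_ge0 // ?ler0z //; lra.
have : 1 <= `|d - 1|%:~R :> R by rewrite ler1z; lia.
lra.
Qed.

Lemma right_rate_after (d : int) : right_rate R d + rho <= (1 + rho) * `|d + 1|%:~R.
Proof.
rewrite /right_rate /rho; case: ifP => d0; last first.
  by rewrite addNr mulr_ge0 // ?ler0z //; lra.
have : 1 <= `|d + 1|%:~R :> R by rewrite ler1z; lia.
lra.
Qed.

(** The path of the edge had nonnegative cost [f - rho * c] with [f + c] its length, so the part [f]
    where it does not cancel flow is at least [rho / (1 + rho)] of the length. There the flow is now
    nonzero, and [(1 + rho) / rho = 25]. *)
Lemma edge_len_le_flow e h : valid (e :: h) ->
  edge_len e <= 25%:R * total (fun x => `|flow (e :: h) x|%:~R).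
Proof.
move=> [[[lF rF] [bt rp] _ _] v]; have /andP[/ltW lr /ltW rr] := bt.
have lT := T_pts (free_sub lF); have rT := T_pts (free_sub rF).
have pos x : x \in pts -> 0 <= `|flow (e :: h) x|%:~R * (1 + rho) :> R.
  by move=> _; rewrite mulr_ge0 ?ler0z // /rho; lra.
rewrite /edge_len /server; case dir: (goes_left e).
  have A := (valid_nonneg T_pts v lF rp).1 lr.
  have B : integral (left_free e) (request e) (fun x => left_rate R (flow h x) + rho * 1) <=
           total (fun x => `|flow (e :: h) x|%:~R * (1 + rho)).
    apply: integral_le_total => // x _ lx xr.
    rewrite (_ : flow (e :: h) x = flow h x - 1); last first.
      by rewrite flow_cons flow1E // dir lx xr /= addrC.
    by rewrite mulr1 [leRHS]mulrC left_rate_after.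
  move: B; rewrite integralD integralZ integral1 // -/(left_cost _ _ _ _).
  rewrite [X in _ <= X](_ : _ = (1 + rho) * total (fun x => `|flow (e :: h) x|%:~R)); last first.
    by rewrite -totalZ; apply: total_eq => x _; rewrite mulrC.
  rewrite ger0_norm ?subr_ge0 //; move: A; rewrite /rho; lra.
have A := (valid_nonneg T_pts v rF rp).2 rr.
have B : integral (request e) (right_free e) (fun x => right_rate R (flow h x) + rho * 1) <=
         total (fun x => `|flow (e :: h) x|%:~R * (1 + rho)).
  apply: integral_le_total => // x _ lx xr.
  rewrite (_ : flow (e :: h) x = flow h x + 1); last first.
    by rewrite flow_cons flow1E // dir lx xr /= addrC.
  by rewrite mulr1 [leRHS]mulrC right_rate_after.
move: B; rewrite integralD integralZ integral1 // -/(right_cost _ _ _ _).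
rewrite [X in _ <= X](_ : _ = (1 + rho) * total (fun x => `|flow (e :: h) x|%:~R)); last first.
  by rewrite -totalZ; apply: total_eq => x _; rewrite mulrC.
rewrite distrC ger0_norm ?subr_ge0 //; move: A; rewrite /rho; lra.
Qed.

(** [edge_len_le_flow] and the flow bound are applied to the part of the history that ends with [e];
    600 is [25 / rho]. *)
Lemma edge_len_le_dual O h e : valid h -> dual_bound O h -> e \in h ->
  edge_len e <= 600%:R * O.
Proof.
move=> v db eh; case/splitPr: eh v db => h1 h2 v db.
have v2 := valid_cat v.
have := flow_le_dual pts_uniq T_uniq T_pts v2 (dual_bound_cat v db).
by have := edge_len_le_flow v2; rewrite /rho; lra.
Qed.

Lemma sum_norm_same_sign (I : eqType) (s : seq I) (P : pred I) (F : I -> int) :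
  (forall i, i \in s -> P i -> 0 <= F i) \/ (forall i, i \in s -> P i -> F i <= 0) ->
  `|\sum_(i <- s | P i) F i| = \sum_(i <- s | P i) `|F i|.
Proof.
rewrite !(big_seq_cond P); case=> H.
  rewrite ger0_norm; first by apply: eq_bigr => i /andP[*]; rewrite ger0_norm ?H.
  by apply: sumr_ge0 => i /andP[*]; exact: H.
rewrite ler0_norm; first by rewrite -sumrN; apply: eq_bigr => i /andP[*]; rewrite ler0_norm ?H.
by apply: sumr_le0 => i /andP[*]; exact: H.
Qed.

(* When the spans exceed twice the edge lengths, the leftward and the rightward
   edges stay near opposite ends of their intervals and cannot overlap. *)
Lemma sum_large_spans (c L : R) h : valid h ->
  (forall e, e \in h -> edge_len e <= c) -> 2%:R * c < L ->
  \sum_(e <- h | ~~ (span e < L)) edge_len e <=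
  total (fun x => `|flow h x|%:~R) + total (fun x => `|flow [seq e <- h | span e < L] x|%:~R).
Proof.
move=> v hc cL; apply: le_trans (total_norm_flow_filter _ _ _).
rewrite big_seq_cond (eq_bigr (fun e => total (fun x => `|flow [:: e] x|%:~R))); last first.
  by move=> e /andP[eh _]; exact: edge_len_total v eh.
rewrite -big_seq_cond -total_sum; apply: le_total_fun => x _.
rewrite sum_norm_same_sign ?rmorph_sum //=.
have key e e' : e \in h -> e' \in h -> ~~ (span e < L) -> ~~ (span e' < L) ->
    0 < flow [:: e] x -> flow [:: e'] x < 0 -> False.
  move=> eh eh' se se'; have be := valid_between v eh; have be' := valid_between v eh'.
  have := hc _ eh; have := hc _ eh'; rewrite /edge_len /server !flow1E //.
  case: (goes_left e); first by case: (_ <= x < _)%R.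
  case: (goes_left e'); last first.
    by case: (request e' <= x < right_free e')%R; rewrite //= => _ _ _.
  case: (boolP (request e <= x < right_free e)%R) => // /andP[rx xr].
  case: (boolP (left_free e' <= x < request e')%R) => //= /andP[lx' xr'].
  move=> /ler_normlP[_ A] /ler_normlP[B _] _ _.
  move: be be'; rewrite /between => /andP[lr rr] /andP[lr' rr'].
  have [] := nested v eh eh'; [lra|lra| |] => -[]; move: se se'; rewrite /span -!leNgt; lra.
have [/hasP[e eh /andP[se fe]]|/hasPn H] :=
    boolP (has (fun e => ~~ (span e < L) && (0 < flow [:: e] x)) h).
  by left=> e' eh' se'; rewrite leNgt; apply/negP; exact: key eh eh' se se' fe.
by right=> e' eh' se'; rewrite leNgt; have := H _ eh'; rewrite se'.
Qed.

End LongEdges.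

(** * Entries with spans in [L, 3L/2) *)

Section Sweeps.
Variable R : realType.
Implicit Types (e : entry R) (h : seq (entry R)).
Variables (pts T : seq R).
Hypothesis pts_uniq : uniq pts.
Hypothesis T_pts : {subset T <= pts}.

Local Notation integral := (integral pts).
Local Notation total := (total pts).
Local Notation valid := (valid pts T).
Local Notation rho := (rho R).

Lemma integral_le_add a b c d (f g k : R -> R) :
  (forall x, x \in pts -> a <= x -> x < b -> f x <= g x + (c <= x < d)%R%:R * k x) ->
  (forall x, 0 <= k x) -> integral a b f <= integral a b g + integral c d k.
Proof.
move=> fg k0; rewrite !integral_total -totalD; apply: le_total_fun => x xp.
have K : 0 <= (c <= x < d)%R%:R * k x by rewrite mulr_ge0.
case: (boolP (a <= x < b)%R) => [/andP[ax xb]|_]; last by rewrite !mul0r add0r.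
by rewrite !mul1r fg.
Qed.

(** Taking the farther right server requires the right cost to be below [rho] times the left cost,
    and the latter is at most the distance to the left server. As the rightward rate plus [rho]
    dominates the indicator of nonnegative flow, [rho] times both distances bounds its integral. *)
Lemma right_sweep_flow h e : step_ok pts T h e -> ~~ goes_left e ->
  request e - left_free e < right_free e - request e ->
  integral (request e) (right_free e) (fun x => (0 <= flow h x)%R%:R) <= rho * span e.
Proof.
move=> [[lF rF] [bt rp] _ ch] /negbTE dir dd; have /andP[/ltW lr /ltW rr] := bt.
have lT := T_pts (free_sub lF); have rT := T_pts (free_sub rF).
move: ch; rewrite /choice_ok dir /toward_left => -[_ [|XR]]; first by rewrite leNgt dd.
have XL : left_cost pts h (left_free e) (request e) <= request e - left_free e.
  rewrite -(integral1 pts_uniq lT rp lr); apply: le_integral => x _ _ _.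
  by rewrite /left_rate /rho; case: ifP => _; lra.
have A : integral (request e) (right_free e) (fun x => (0 <= flow h x)%R%:R) <=
    integral (request e) (right_free e) (fun x => right_rate R (flow h x) + rho * 1).
  apply: le_integral => x _ _ _; rewrite /right_rate /rho.
  by case: (0 <= flow h x) => /=; lra.
move: A; rewrite integralD integralZ integral1 // -/(right_cost _ _ _ _).
by move: XR XL; rewrite /span /rho; lra.
Qed.

Lemma left_sweep_flow h e : step_ok pts T h e -> goes_left e ->
  right_free e - request e < request e - left_free e ->
  integral (left_free e) (request e) (fun x => (flow h x <= 0)%R%:R) <= rho * span e.
Proof.
move=> [[lF rF] [bt rp] _ ch] dir dd; have /andP[/ltW lr /ltW rr] := bt.
have lT := T_pts (free_sub lF); have rT := T_pts (free_sub rF).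
move: ch; rewrite /choice_ok dir /toward_left => -[_ [|XR]]; first by rewrite leNgt dd.
have XL : right_cost pts h (request e) (right_free e) <= right_free e - request e.
  rewrite -(integral1 pts_uniq rp rT rr); apply: le_integral => x _ _ _.
  by rewrite /right_rate /rho; case: ifP => _; lra.
have A : integral (left_free e) (request e) (fun x => (flow h x <= 0)%R%:R) <=
    integral (left_free e) (request e) (fun x => left_rate R (flow h x) + rho * 1).
  apply: le_integral => x _ _ _; rewrite /left_rate /rho.
  by case: (flow h x <= 0) => /=; lra.
move: A; rewrite integralD integralZ integral1 // -/(left_cost _ _ _ _).
by move: XR XL; rewrite /span /rho; lra.
Qed.

Variables (L a b : R).
Hypothesis L_gt0 : 0 < L.
Hypothesis ab_len : L <= b - a.
Hypotheses (a_pts : a \in pts) (b_pts : b \in pts).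
Hypotheses (a4_pts : a + L / 4%:R \in pts) (b4_pts : b - L / 4%:R \in pts).

Definition contains e := (left_free e <= a) && (b <= right_free e).

(* Edges crossing almost all of the interval towards its far end. *)
Definition right_sweep e := [&& contains e, ~~ goes_left e & request e < a + L / 4%:R].
Definition left_sweep e := [&& contains e, goes_left e & b - L / 4%:R <= request e].

Definition pos_part (d : int) : R := (Num.max d 0)%:~R.

Lemma pos_part_le d d' : d <= d' -> pos_part d <= pos_part d'.
Proof. by move=> dd; rewrite /pos_part ler_int; lia. Qed.

Lemma pos_part_sub1 d : pos_part (d - 1) + 1 <= pos_part d + (d <= 0)%R%:R.
Proof.
have : (Num.max (d - 1) 0 + 1)%:~R <= (Num.max d 0 + ((d <= 0)%R : nat)%:Z)%:~R :> R.
  by rewrite ler_int; case: (leP d 0) => /=; lia.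
by rewrite !rmorphD.
Qed.

Lemma pos_part_add1 d : pos_part (d + 1) <= pos_part d + (0 <= d)%R%:R.
Proof.
have : (Num.max (d + 1) 0)%:~R <= (Num.max d 0 + ((0 <= d)%R : nat)%:Z)%:~R :> R.
  by rewrite ler_int; case: (leP 0 d) => /=; lia.
by rewrite !rmorphD.
Qed.

Lemma pos_part_norm d : pos_part d <= `|d|%:~R.
Proof. by rewrite /pos_part ler_int; lia. Qed.

Definition nested_or_disjoint e :=
  [\/ right_free e <= a, b <= left_free e | contains e].

(* A leftward sweep removes positive flow near the left end, of which a rightward
   sweep creates little because it meets mostly negative flow. *)
Lemma left_sweep_bound k h : valid (k ++ h) ->
  (forall e, e \in k -> nested_or_disjoint e /\ span e < 3%:R / 2%:R * L) ->
  (count left_sweep k)%:R * (L / 4%:R - L / 16%:R) +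
    integral a (a + L / 4%:R) (fun x => pos_part (flow (k ++ h) x)) <=
  integral a (a + L / 4%:R) (fun x => pos_part (flow h x)) +
    (count right_sweep k)%:R * (L / 16%:R).
Proof.
have [Lp abl] := (L_gt0, ab_len).
elim: k => [|e k IH]; first by rewrite /= !mul0r add0r addr0.
move=> [st v] hk; have {}IH := IH v (fun f fk => hk f (mem_behead (s := e :: k) fk)).
have [nd se] := hk e (mem_head e k); set h' := k ++ h in st v IH *.
rewrite cat_cons -/h' [count _ (_ :: _)]/= [X in _ <= _ + X]/= !natrD.
have [_ [bt rp] _ _] := st; have /andP[lr rr] := bt.
have le0 : (forall x, a <= x -> x < a + L / 4%:R -> flow (e :: h') x <= flow h' x) ->
    integral a (a + L / 4%:R) (fun x => pos_part (flow (e :: h') x)) <=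
    integral a (a + L / 4%:R) (fun x => pos_part (flow h' x)).
  by move=> H; apply: le_integral => // x _ ax xa; rewrite pos_part_le ?H.
case: (boolP (contains e)) => ce; last first.
  have -> : left_sweep e = false by rewrite /left_sweep (negbTE ce).
  have -> : right_sweep e = false by rewrite /right_sweep (negbTE ce).
  rewrite /= ?add0r.
  suff : integral a (a + L / 4%:R) (fun x => pos_part (flow (e :: h') x)) <=
    integral a (a + L / 4%:R) (fun x => pos_part (flow h' x)) by lra.
  apply: le0 => x ax xa; rewrite flow_cons flow1_out ?add0r // /covers.
  rewrite negb_and -ltNge -leNgt; case: nd => [ra|bl|]; last by rewrite (negbTE ce).
    by rewrite (le_trans ra ax) orbT.
  by have -> : x < left_free e by lra.
have /andP[la br] := ce.
have -> : left_sweep e = goes_left e && (b - L / 4%:R <= request e).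
  by rewrite /left_sweep ce.
have -> : right_sweep e = ~~ goes_left e && (request e < a + L / 4%:R).
  by rewrite /right_sweep ce.
case dir: (goes_left e) => /=.
  case: (leP (b - L / 4%:R) (request e)) => [bq|qb] /=; last first.
    suff : integral a (a + L / 4%:R) (fun x => pos_part (flow (e :: h') x)) <=
      integral a (a + L / 4%:R) (fun x => pos_part (flow h' x)) by lra.
    by apply: le0 => x _ _; rewrite flow_cons flow1E // dir gerDr oppr_le0.
  (* The left server is the farther one: it is at least [3L/4] away, and the span is below [3L/2].
     The latter also puts [rho * span e] below [L/16]. *)
  have S : integral (left_free e) (request e) (fun x => (flow h' x <= 0)%R%:R) <= rho * span e.
    by apply: left_sweep_flow => //; move: se la br; rewrite /span; lra.
  have A : integral a (a + L / 4%:R) (fun x => pos_part (flow (e :: h') x) + 1) <=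
      integral a (a + L / 4%:R) (fun x => pos_part (flow h' x)) +
      integral (left_free e) (request e) (fun x => (flow h' x <= 0)%R%:R).
    apply: integral_le_add => // x _ ax xa.
    have lx : left_free e <= x by rewrite (le_trans la).
    have xq : x < request e by lra.
    by rewrite flow_cons flow1E // dir lx xq /= mul1r [- _ + _]addrC pos_part_sub1.
  move: A; rewrite integralD integral1 //; last by lra.
  by move: S se; rewrite /rho /span; lra.
case: (ltP (request e) (a + L / 4%:R)) => [qa|aq] /=; last first.
  suff : integral a (a + L / 4%:R) (fun x => pos_part (flow (e :: h') x)) <=
    integral a (a + L / 4%:R) (fun x => pos_part (flow h' x)) by lra.
  apply: le0 => x ax xa; rewrite flow_cons flow1E // dir.
  by rewrite (_ : (request e <= x) = false) ?add0r //; apply/negbTE; rewrite -ltNge; lra.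
have S : integral (request e) (right_free e) (fun x => (0 <= flow h' x)%R%:R) <= rho * span e.
  by apply: right_sweep_flow => //; rewrite ?dir //; move: se la br; rewrite /span; lra.
have A : integral a (a + L / 4%:R) (fun x => pos_part (flow (e :: h') x)) <=
    integral a (a + L / 4%:R) (fun x => pos_part (flow h' x)) +
    integral (request e) (right_free e) (fun x => (0 <= flow h' x)%R%:R).
  apply: integral_le_add => // x _ ax xa.
  rewrite flow_cons flow1E // dir; case: (_ <= x < _)%R => /=; last by rewrite add0r mul0r addr0.
  by rewrite mul1r [1%:Z + _]addrC pos_part_add1.
by move: S A se; rewrite /rho /span; lra.
Qed.

(** The mirror image of [left_sweep_bound]: near the right end, rightward sweeps remove negative
    flow and leftward sweeps create little of it. *)
Lemma right_sweep_bound k h : valid (k ++ h) ->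
  (forall e, e \in k -> nested_or_disjoint e /\ span e < 3%:R / 2%:R * L) ->
  (count right_sweep k)%:R * (L / 4%:R - L / 16%:R) +
    integral (b - L / 4%:R) b (fun x => pos_part (- flow (k ++ h) x)) <=
  integral (b - L / 4%:R) b (fun x => pos_part (- flow h x)) +
    (count left_sweep k)%:R * (L / 16%:R).
Proof.
have [Lp abl] := (L_gt0, ab_len).
elim: k => [|e k IH]; first by rewrite /= !mul0r add0r addr0.
move=> [st v] hk; have {}IH := IH v (fun f fk => hk f (mem_behead (s := e :: k) fk)).
have [nd se] := hk e (mem_head e k); set h' := k ++ h in st v IH *.
rewrite cat_cons -/h' [count _ (_ :: _)]/= [X in _ <= _ + X]/= !natrD.
have [_ [bt rp] _ _] := st; have /andP[lr rr] := bt.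
have le0 : (forall x, b - L / 4%:R <= x -> x < b -> flow h' x <= flow (e :: h') x) ->
    integral (b - L / 4%:R) b (fun x => pos_part (- flow (e :: h') x)) <=
    integral (b - L / 4%:R) b (fun x => pos_part (- flow h' x)).
  by move=> H; apply: le_integral => // x _ ax xa; rewrite pos_part_le ?lerN2 ?H.
case: (boolP (contains e)) => ce; last first.
  have -> : left_sweep e = false by rewrite /left_sweep (negbTE ce).
  have -> : right_sweep e = false by rewrite /right_sweep (negbTE ce).
  rewrite /= ?add0r.
  suff : integral (b - L / 4%:R) b (fun x => pos_part (- flow (e :: h') x)) <=
    integral (b - L / 4%:R) b (fun x => pos_part (- flow h' x)) by lra.
  apply: le0 => x bx xb; rewrite flow_cons flow1_out ?add0r // /covers.
  rewrite negb_and -ltNge -leNgt; case: nd => [ra|bl|]; last by rewrite (negbTE ce).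
    by rewrite orbC; have -> : right_free e <= x by lra.
  by rewrite (lt_le_trans xb bl).
have /andP[la br] := ce.
have -> : left_sweep e = goes_left e && (b - L / 4%:R <= request e).
  by rewrite /left_sweep ce.
have -> : right_sweep e = ~~ goes_left e && (request e < a + L / 4%:R).
  by rewrite /right_sweep ce.
case dir: (goes_left e) => /=; last first.
  case: (ltP (request e) (a + L / 4%:R)) => [qa|aq] /=; last first.
    suff : integral (b - L / 4%:R) b (fun x => pos_part (- flow (e :: h') x)) <=
      integral (b - L / 4%:R) b (fun x => pos_part (- flow h' x)) by lra.
    by apply: le0 => x _ _; rewrite flow_cons flow1E // dir lerDr.
  have S : integral (request e) (right_free e) (fun x => (0 <= flow h' x)%R%:R) <= rho * span e.
    by apply: right_sweep_flow; rewrite ?dir //; move: se la br; rewrite /span; lra.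
  have A : integral (b - L / 4%:R) b (fun x => pos_part (- flow (e :: h') x) + 1) <=
      integral (b - L / 4%:R) b (fun x => pos_part (- flow h' x)) +
      integral (request e) (right_free e) (fun x => (0 <= flow h' x)%R%:R).
    apply: integral_le_add => // x _ bx xb.
    have xr : x < right_free e by rewrite (lt_le_trans xb).
    have qx : request e <= x by lra.
    rewrite flow_cons flow1E // dir qx xr /= mul1r opprD [- _ - _]addrC.
    by rewrite -[0 <= _]oppr_le0 pos_part_sub1.
  move: A; rewrite integralD integral1 //; last by lra.
  by move: S se; rewrite /rho /span; lra.
case: (leP (b - L / 4%:R) (request e)) => [bq|qb] /=; last first.
  suff : integral (b - L / 4%:R) b (fun x => pos_part (- flow (e :: h') x)) <=
    integral (b - L / 4%:R) b (fun x => pos_part (- flow h' x)) by lra.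
  apply: le0 => x bx xb; rewrite flow_cons flow1E // dir.
  by rewrite (_ : (x < request e) = false) ?andbF ?oppr0 ?add0r //;
    apply/negbTE; rewrite -leNgt; lra.
have S : integral (left_free e) (request e) (fun x => (flow h' x <= 0)%R%:R) <= rho * span e.
  by apply: left_sweep_flow; rewrite ?dir //; move: se la br; rewrite /span; lra.
have A : integral (b - L / 4%:R) b (fun x => pos_part (- flow (e :: h') x)) <=
    integral (b - L / 4%:R) b (fun x => pos_part (- flow h' x)) +
    integral (left_free e) (request e) (fun x => (flow h' x <= 0)%R%:R).
  apply: integral_le_add => // x _ bx xb.
  rewrite flow_cons flow1E // dir; case: (_ <= x < _)%R => /=; last first.
    by rewrite oppr0 add0r mul0r addr0.
  rewrite mul1r opprD opprK [1%:Z - _]addrC.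
  by rewrite -[_ <= 0]oppr_ge0 pos_part_add1.
by move: S A se; rewrite /rho /span; lra.
Qed.

(** In the sum of the two mirror bounds each sweep gains [3L/16] and costs at most [L/16]. The
    difference [L/8] gives the factor 8. *)
Lemma sweeps_le_flow k h : valid (k ++ h) ->
  (forall e, e \in k -> nested_or_disjoint e /\ span e < 3%:R / 2%:R * L) ->
  (count left_sweep k + count right_sweep k)%:R * L <=
  8%:R * integral a b (fun x => `|flow h x|%:~R).
Proof.
have [Lp abl] := (L_gt0, ab_len).
move=> v hk; have := left_sweep_bound v hk; have := right_sweep_bound v hk.
have p0 f c d : 0 <= integral c d (fun x => pos_part (f x)).
  by apply: integral_ge0 => x _ _ _; rewrite /pos_part ler0z; lia.
have := p0 (fun x => - flow (k ++ h) x) (b - L / 4%:R) b.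
have := p0 (flow (k ++ h)) a (a + L / 4%:R).
have ab4 : a + L / 4%:R <= b - L / 4%:R by lra.
have a4 : a <= a + L / 4%:R by lra.
have b4 : b - L / 4%:R <= b by lra.
rewrite (integral_cat _ _ a4 (le_trans ab4 b4)) (integral_cat _ _ ab4 b4).
have A : integral a (a + L / 4%:R) (fun x => pos_part (flow h x)) <=
    integral a (a + L / 4%:R) (fun x => `|flow h x|%:~R).
  by apply: le_integral => x _ _ _; exact: pos_part_norm.
have B : integral (b - L / 4%:R) b (fun x => pos_part (- flow h x)) <=
    integral (b - L / 4%:R) b (fun x => `|flow h x|%:~R).
  by apply: le_integral => x _ _ _; rewrite -normrN pos_part_norm.
have C : 0 <= integral (a + L / 4%:R) (b - L / 4%:R) (fun x => `|flow h x|%:~R).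
  by apply: integral_ge0 => x _ _ _; rewrite ler0z.
move: A B C; rewrite natrD; lra.
Qed.

End Sweeps.

(** * Grouping the arrivals of one level by base intervals *)

Section Level.
Variable R : realType.
Implicit Types (e b : entry R) (h : seq (entry R)).
Variables (pts T : seq R).
Hypothesis pts_uniq : uniq pts.
Hypothesis T_pts : {subset T <= pts}.

Local Notation integral := (integral pts).
Local Notation total := (total pts).
Local Notation valid := (valid pts T).

Lemma flow_cat h1 h2 x : flow (h1 ++ h2) x = flow h1 x + flow h2 x.
Proof. by rewrite /flow map_cat net_cat. Qed.

Definition holds b e := contains (left_free b) (right_free b) e.

Lemma holds_span b e : holds b e -> span b <= span e.
Proof. by rewrite /holds /contains /span => /andP[? ?]; rewrite lerB. Qed.

(* The oldest of the nested intervals of length at least L. *)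
Fixpoint bases (L : R) h : seq (entry R) :=
  if h is e :: h' then
    if (L <= span e) && ~~ has (holds^~ e) (bases L h') then e :: bases L h' else bases L h'
  else [::].

Lemma bases_sub L h : {subset bases L h <= h}.
Proof.
elim: h => //= e h IH b; case: ifP => _; last by move=> /IH bh; rewrite inE bh orbT.
by rewrite !inE => /orP[->//|/IH->]; rewrite orbT.
Qed.

Lemma has_base L h e : e \in h -> L <= span e -> has (holds^~ e) (bases L h).
Proof.
elim: h => //= f h IH; rewrite inE => /orP[/eqP->|/IH {}IH] Ls.
  case: ifP => [_|/negbT] /=; first by rewrite /holds /contains !lexx.
  by rewrite Ls /= negbK.
by case: ifP => _ /=; rewrite ?IH ?orbT.
Qed.

Definition disjoint_entries b e := right_free e <= left_free b \/ right_free b <= left_free e.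

Lemma base_split L h b : valid h -> b \in bases L h -> exists h2 h1,
  [/\ h = h2 ++ b :: h1, L <= span b,
      forall e, e \in h1 -> L <= span e -> disjoint_entries b e &
      forall e, e \in rcons h2 b -> nested_or_disjoint (left_free b) (right_free b) e].
Proof.
elim: h => //= f h IH [st v]; set c := _ && _.
have [bf|bf] := boolP (c && (b == f)).
  have /andP[/andP[Ls nh] /eqP ->] := bf; move=> _; exists [::], h; split=> //.
    move=> e eh Le; have [//|lr] := leP (right_free e) (left_free f); first by left.
    have [//|rl] := leP (right_free f) (left_free e); first by right.
    have [a d] := newer_contains (conj st v : valid (f :: h)) eh lr rl.
    case/negP: nh; have /hasP[b' bb' /andP[x y]] := has_base eh Le; apply/hasP; exists b' => //.
    by rewrite /holds /contains (le_trans a x) (le_trans y d).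
  by move=> e; rewrite inE => /eqP->; apply: Or33; rewrite /contains !lexx.
have sub : b \in (if c then f :: bases L h else bases L h) -> b \in bases L h.
  by move: bf; case: c => //=; rewrite inE => /negbTE->.
move=> /sub/(IH v)[h2 [h1 [hE Lb dj nd]]]; exists (f :: h2), h1; split=> //; first by rewrite hE.
move=> e; rewrite /= inE => /orP[/eqP->|]; last exact: nd.
have [rl|lr] := leP (right_free f) (left_free b); first exact: Or31.
have [rb|bl] := leP (right_free b) (left_free f); first exact: Or32.
have bh : b \in h by rewrite hE mem_cat inE eqxx orbT.
have [x y] := newer_contains (conj st v : valid (f :: h)) bh bl lr.
by apply: Or33; rewrite /contains x y.
Qed.

Variables (L : R) (g : seq (entry R)).
Hypothesis L_gt0 : 0 < L.
Hypothesis g_valid : valid g.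
Hypothesis g_span : forall e, e \in g -> span e < 3%:R / 2%:R * L.
Hypothesis g_grid : forall e, e \in g ->
  left_free e + L / 4%:R \in pts /\ right_free e - L / 4%:R \in pts.

Definition small := [seq e <- g | span e < L].
(** This dominates the flow of the arrivals with span at least [L], which is the difference of the
    two flows. Both belong to valid runs, so [flow_le_dual] applies to each. *)
Definition flows x : R := `|flow g x|%:~R + `|flow small x|%:~R.
Definition hull b x := has (fun e => holds b e && covers e x) g.

Lemma flows_ge0 x : 0 <= flows x.
Proof. by rewrite addr_ge0 // ler0z. Qed.

Lemma base_contained b e : b \in bases L g -> e \in g -> L <= span e ->
  left_free e < right_free b -> left_free b < right_free e -> holds b e.
Proof.
move=> bb eg Le lr rl; have [h2 [h1 [gE Lb dj nd]]] := base_split g_valid bb.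
move: eg; rewrite gE -cat_rcons mem_cat => /orP[/nd[]|/dj/(_ Le)[]] //; try by rewrite leNgt ?lr ?rl.
Qed.

(* Two disjoint intervals of length at least L do not fit in a span below 3L/2. *)
Lemma hull_stage b x : b \in bases L g -> hull b x ->
  \sum_(e <- g | holds b e) flow [:: e] x = \sum_(e <- g | ~~ (span e < L)) flow [:: e] x.
Proof.
move=> bb /hasP[f fg /andP[hf cf]].
have [_ [_ [_ Lb _ _]]] := base_split g_valid bb.
rewrite big_mkcond [RHS]big_mkcond; apply: eq_big_seq => e eg; rewrite -leNgt.
case: (boolP (holds b e)) => [/holds_span be|nh]; first by rewrite (le_trans Lb be).
case: leP => // Le; rewrite flow1_out ?(valid_between g_valid) //; apply/negP => ce.
case/negP: nh; move: (ce) (cf); rewrite /covers => /andP[le er] /andP[lf fr].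
have [||[a d]|[a d]] := nested g_valid eg fg; rewrite ?(le_lt_trans le) ?(le_lt_trans lf) //.
  move: hf; rewrite /holds /contains => /andP[u w].
  by rewrite (le_trans a u) (le_trans w d).
have sf := g_span fg; move: hf; rewrite /holds /contains => /andP[u w].
have Lp := L_gt0.
apply: base_contained => //; rewrite ltNge; apply/negP => bad;
  move: Le Lb sf; rewrite /span; lra.
Qed.

Definition left_cover e x : R := (left_free e <= x < request e)%R%:R.
Definition right_cover e x : R := (request e <= x < right_free e)%R%:R.

Lemma group_flowE b x : (\sum_(e <- g | holds b e) flow [:: e] x)%:~R =
  \sum_(e <- g | holds b e && ~~ goes_left e) right_cover e x -
  \sum_(e <- g | holds b e && goes_left e) left_cover e x.
Proof.
rewrite rmorph_sum (bigID (@goes_left R)) /= addrC big_seq_cond [X in _ + X]big_seq_cond.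
rewrite [in RHS]big_seq_cond [X in _ = _ - X]big_seq_cond -sumrN.
congr (_ + _); apply: eq_bigr => e /and3P[eg _ dir]; rewrite flow1E ?(valid_between g_valid) //.
  by rewrite (negbTE dir).
by rewrite dir rmorphN.
Qed.

(** On the hull, the edges held by [b] carry the whole flow of the long arrivals by [hull_stage],
    and this is [flow g x - flow small x]. Off the hull they carry none. *)
Lemma group_balance b x : b \in bases L g ->
  `| \sum_(e <- g | holds b e && ~~ goes_left e) right_cover e x -
     \sum_(e <- g | holds b e && goes_left e) left_cover e x | <= (hull b x)%:R * flows x.
Proof.
move=> bb; rewrite -group_flowE -intr_norm; case: (boolP (hull b x)) => hb; last first.
  rewrite mul0r big_seq_cond big1 ?normr0 // => e /andP[eg he].
  rewrite flow1_out ?(valid_between g_valid) //; apply: contra hb => ce.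
  by apply/hasP; exists e; rewrite ?he.
rewrite mul1r hull_stage // /flows -rmorphD ler_int /=.
rewrite (flow_filter_cat g (fun e => span e < L)) -/small.
set u := flow small x; set w := \sum_(_ <- _ | _) _.
by rewrite -[w in X in X <= _](addrK u) [w + u]addrC ler_normB.
Qed.

(** [sweeps_le_flow] starts from the flow [flow h1] just before the base arrived. On the base
    interval this equals [flow small]: older long intervals are disjoint from it, and later ones
    that meet it contain it, so they are not small. *)
Lemma sweeps_le_hull b : b \in bases L g ->
  (count (left_sweep L (left_free b) (right_free b)) g +
   count (right_sweep L (left_free b) (right_free b)) g)%:R * L <=
  8%:R * total (fun x => (hull b x)%:R * flows x).
Proof.
move=> bb; have [h2 [h1 [gE Lb dj nd]]] := base_split g_valid bb.
have bg : b \in g := bases_sub bb.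
have [lT rT] := ends_T g_valid bg; have [l4 r4] := g_grid bg.
have vk : valid (rcons h2 b ++ h1) by rewrite cat_rcons -gE.
have hk e : e \in rcons h2 b ->
    nested_or_disjoint (left_free b) (right_free b) e /\ span e < 3%:R / 2%:R * L.
  by move=> ek; split; [exact: nd|apply: g_span; rewrite gE -cat_rcons mem_cat ek].
have := sweeps_le_flow pts_uniq T_pts L_gt0 Lb (T_pts lT) (T_pts rT) l4 r4 vk hk.
have none e : e \in h1 -> ~~ contains (left_free b) (right_free b) e.
  move=> eh; apply/negP => ce; have Le : L <= span e := le_trans Lb (holds_span ce).
  have /andP[lr rr] := valid_between g_valid bg.
  have := lt_trans lr rr; move: ce; rewrite /contains => /andP[x y].
  by case: (dj e eh Le) => [z|z]; rewrite ltNge; [rewrite (le_trans y z)|rewrite (le_trans z x)].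
have c0 (p : pred (entry R)) : {in h1, p =1 pred0} -> count p g = count p (rcons h2 b).
  move=> p0; rewrite gE -cat_rcons count_cat [X in (_ + X)%N](_ : _ = 0%N) ?addn0 //.
  by apply/eqP; rewrite -leqn0 leqNgt -has_count; apply/hasPn => e /p0 /= ->.
rewrite -!c0; first last.
- by move=> e eh; rewrite /left_sweep (negbTE (none e eh)).
- by move=> e eh; rewrite /right_sweep (negbTE (none e eh)).
move/le_trans; apply; rewrite ler_pM2l //; apply: integral_le_total.
  by move=> x _; rewrite mulr_ge0 ?flows_ge0.
move=> x _ lx xr; have -> : hull b x.
  by apply/hasP; exists b; rewrite // /holds /contains !lexx /covers lx xr.
rewrite mul1r /flows [X in X <= _](_ : _ = `|flow small x|%:~R); last first.
  congr (`|_|%:~R); rewrite /small gE -cat_rcons filter_cat.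
  rewrite flow_cat (flow_filter (valid_cat vk)).
    rewrite (_ : flow [seq e <- rcons h2 b | span e < L] x = 0) ?add0r //.
    rewrite flow_sum big_seq big1 // => e; rewrite mem_filter => /andP[sL ek].
    have eg : e \in g by rewrite gE -cat_rcons mem_cat ek.
    apply: flow1_out; first exact: valid_between g_valid eg.
    rewrite /covers; apply/negP => /andP[le er].
    case: (nd e ek) => [z|z|ce].
    - by move: (le_lt_trans lx er); rewrite ltNge z.
    - by move: (le_lt_trans le xr); rewrite ltNge z.
    - by move: (le_lt_trans (le_trans Lb (holds_span ce)) sL); rewrite ltxx.
  move=> e eh /andP[le er]; rewrite ltNge; apply/negP => Le.
  case: (dj e eh Le) => z; first by move: (le_lt_trans lx er); rewrite ltNge z.
  by move: (le_lt_trans le xr); rewrite ltNge z.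
by rewrite lerDr ler0z.
Qed.

Lemma total_sum_le (P : pred (entry R)) (C : R) (F : entry R -> R -> R)
    (N : entry R -> bool) : 0 <= C ->
  (forall e, e \in g -> P e -> total (F e) <= C * (N e)%:R) ->
  (forall e, N e -> P e) ->
  total (fun x => \sum_(e <- g | P e) F e x) <= C * (count N g)%:R.
Proof.
move=> C0 H NP; rewrite total_sum -sum1_count natr_sum mulr_sumr.
rewrite [leRHS]big_mkcond [leLHS]big_mkcond !big_seq; apply: ler_sum => e eg.
case: (boolP (P e)) => Pe; last by case: (boolP (N e)) => // /NP; rewrite (negbTE Pe).
by apply: le_trans (H e eg Pe) _; case: (N e); rewrite ?mulr1 ?mulr0.
Qed.

(** A leftward edge of the group is shorter than [3L/2] and ends at or left of [left_free b], so at
    least a sixth of it lies left of [c]. There [group_balance] compares leftward with rightward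
    edges. The rightward ones starting left of [c] are right sweeps, each contributing at most
    [L/2 + L/4], since its interval exceeds the base by less than [L/2]. *)
Lemma left_group_bound b : b \in bases L g ->
  \sum_(e <- g | holds b e && goes_left e) edge_len e <=
  6%:R * (total (fun x => (hull b x)%:R * flows x) +
    3%:R / 4%:R * L * (count (right_sweep L (left_free b) (right_free b)) g)%:R).
Proof.
move=> bb; have Lp := L_gt0; have bg : b \in g := bases_sub bb.
have [_ [_ [_ Lb _ _]]] := base_split g_valid bb.
set c := left_free b + L / 4%:R; have [c_pts _] := g_grid bg.
pose near x : R := (x < c)%R%:R.
apply: (@le_trans _ _ (6%:R * total (fun x =>
    \sum_(e <- g | holds b e && goes_left e) near x * left_cover e x))).
  rewrite total_sum mulr_sumr [leLHS]big_seq_cond [leRHS]big_seq_cond.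
  apply: ler_sum => e /and3P[eg he dir].
  have be := valid_between g_valid eg; have /andP[lr rr] := be.
  have [/T_pts lT _] := ends_T g_valid eg; have rp := request_pts g_valid eg.
  have lb : left_free e <= left_free b by move: he => /andP[].
  pose m := Num.min (request e) c.
  have mp : m \in pts by rewrite /m; case: leP.
  have lm : left_free e <= m by rewrite le_min (ltW lr) /c; lra.
  have -> : total (fun x => near x * left_cover e x) = m - left_free e.
    rewrite -(integral1 pts_uniq lT mp lm) integral_total; apply: total_eq => x _.
    rewrite /near /left_cover mulr1 lt_min andbA -natrM mulnb andbC.
    by case: (left_free e <= x) => //=; rewrite andbC.
  rewrite /edge_len /server dir ger0_norm ?subr_ge0 ?(ltW lr) //.
  have := g_span eg; rewrite /span /m; case: (leP (request e) c) => _; rewrite /c; lra.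
rewrite ler_pM2l //.
apply: (@le_trans _ _ (total (fun x => (hull b x)%:R * flows x +
    \sum_(e <- g | holds b e && ~~ goes_left e) near x * right_cover e x))).
  apply: le_total_fun => x _; rewrite -!mulr_sumr /near.
  case: (x < c) => /=; last by rewrite !mul0r addr0 mulr_ge0 ?flows_ge0.
  by rewrite !mul1r; have /ler_normlP[A _] := group_balance x bb; move: A; lra.
rewrite totalD lerD2l; apply: total_sum_le; first by lra.
  move=> e eg /andP[he dir].
  have be := valid_between g_valid eg; have /andP[lr rr] := be.
  have rp := request_pts g_valid eg.
  have /andP[lb rb] := he.
  rewrite /right_sweep -/(holds b e) he dir /=; case: ltP => qc; last first.
    rewrite mulr0 [total _](_ : _ = 0) // /total big1 // => x _.
    rewrite /near /right_cover; case: ltP => xc; last by rewrite !mul0r mulr0.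
    by rewrite [(_ <= x)%R]leNgt (lt_le_trans xc qc) /= mulr0 mulr0.
  apply: (@le_trans _ _ (integral (request e) c (fun=> 1))).
    rewrite integral_total; apply: le_total_fun => x _; rewrite /near /right_cover mulr1.
    by case: (x < c); case: (request e <= x) => //=; rewrite ?mul0r ?mulr0 ?mul1r //; case: (x < _).
  rewrite integral1 ?(ltW qc) // mulr1; have := g_span eg; move: Lb; rewrite /span /c; lra.
by move=> e /and3P[he dir _]; rewrite /holds he dir.
Qed.

Lemma right_group_bound b : b \in bases L g ->
  \sum_(e <- g | holds b e && ~~ goes_left e) edge_len e <=
  6%:R * (total (fun x => (hull b x)%:R * flows x) +
    3%:R / 4%:R * L * (count (left_sweep L (left_free b) (right_free b)) g)%:R).
Proof.
move=> bb; have Lp := L_gt0; have bg : b \in g := bases_sub bb.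
have [_ [_ [_ Lb _ _]]] := base_split g_valid bb.
set c := right_free b - L / 4%:R; have [_ c_pts] := g_grid bg.
pose near x : R := (c <= x)%R%:R.
apply: (@le_trans _ _ (6%:R * total (fun x =>
    \sum_(e <- g | holds b e && ~~ goes_left e) near x * right_cover e x))).
  rewrite total_sum mulr_sumr [leLHS]big_seq_cond [leRHS]big_seq_cond.
  apply: ler_sum => e /and3P[eg he dir].
  have be := valid_between g_valid eg; have /andP[lr rr] := be.
  have [_ /T_pts rT] := ends_T g_valid eg; have rp := request_pts g_valid eg.
  have rb : right_free b <= right_free e by move: he => /andP[].
  pose m := Num.max (request e) c.
  have mp : m \in pts by rewrite /m; case: leP.
  have mr : m <= right_free e by rewrite ge_max (ltW rr) /c; lra.
  have -> : total (fun x => near x * right_cover e x) = right_free e - m.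
    rewrite -(integral1 pts_uniq mp rT mr) integral_total; apply: total_eq => x _.
    by rewrite /near /right_cover mulr1 ge_max -natrM mulnb andbA [(c <= x) && _]andbC.
  rewrite /edge_len /server (negbTE dir) distrC ger0_norm ?subr_ge0 ?(ltW rr) //.
  have := g_span eg; rewrite /span /m; case: (leP (request e) c) => _; rewrite /c; lra.
rewrite ler_pM2l //.
apply: (@le_trans _ _ (total (fun x => (hull b x)%:R * flows x +
    \sum_(e <- g | holds b e && goes_left e) near x * left_cover e x))).
  apply: le_total_fun => x _; rewrite -!mulr_sumr /near.
  case: (c <= x) => /=; last by rewrite !mul0r addr0 mulr_ge0 ?flows_ge0.
  by rewrite !mul1r; have /ler_normlP[_ A] := group_balance x bb; move: A; lra.
rewrite totalD lerD2l; apply: total_sum_le; first by lra.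
  move=> e eg /andP[he dir].
  have be := valid_between g_valid eg; have /andP[lr rr] := be.
  have rp := request_pts g_valid eg.
  have /andP[lb rb] := he.
  rewrite /left_sweep -/(holds b e) he dir /=; case: (leP c (request e)) => qc; last first.
    rewrite mulr0 [total _](_ : _ = 0) // /total big1 // => x _.
    rewrite /near /left_cover; case: (leP c x) => xc; last by rewrite !mul0r mulr0.
    by rewrite [(x < _)%R]ltNge (ltW (lt_le_trans qc xc)) andbF mulr0 mulr0.
  apply: (@le_trans _ _ (integral c (request e) (fun=> 1))).
    rewrite integral_total; apply: le_total_fun => x _; rewrite /near /left_cover mulr1.
    by case: (c <= x); case: (x < request e) => //=; rewrite ?andbF ?mul0r ?mulr0 ?mul1r //; case: (_ <= x).
  rewrite integral1 // mulr1; have := g_span eg; move: Lb; rewrite /span /c; lra.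
by move=> e /and3P[he dir _]; rewrite /holds he dir.
Qed.

(** Two intervals covering [x] are nested, so the larger would contain both bases. Being shorter
    than [3L/2], it has no room for two disjoint intervals of length [L]; the bases would meet, and
    the newer would contain the older. *)
Lemma hull_unique x : \sum_(b <- bases L g) (hull b x)%:R <= 1 :> R.
Proof.
have : forall h2 h, g = h2 ++ h -> \sum_(b <- bases L h) (hull b x)%:R <= 1 :> R.
  move=> h2 h; elim: h h2 => [|e h IH] h2 gE /=; first by rewrite big_nil.
  have {}IH := IH (rcons h2 e) (etrans gE (esym (cat_rcons _ _ _))).
  case: ifP => // /andP[Le nh]; rewrite big_cons.
  case: (boolP (hull e x)) => [/hasP[f fg /andP[ef fx]]|_]; last by rewrite add0r.
  rewrite big_seq big1 ?addr0 // => b bb; case: (boolP (hull b x)) => // /hasP[f' fg' /andP[bf' fx']].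
  case/negP: nh; apply/hasP; exists b => //.
  have v : valid (e :: h) by apply: (@valid_cat _ _ _ h2); rewrite -gE.
  have bh := bases_sub bb.
  have [_ [_ [_ Lb _ _]]] := base_split v.2 bb.
  move: fx fx' ef bf'; rewrite /covers /holds /contains.
  move=> /andP[x1 x2] /andP[x3 x4] /andP[x5 x6] /andP[x7 x8].
  have [y1 y2] := (le_lt_trans x1 x4, le_lt_trans x3 x2).
  have Lp := L_gt0; have sf := g_span fg; have sf' := g_span fg'.
  have [a c] : left_free e < right_free b /\ left_free b < right_free e.
    have [[z1 z2]|[z1 z2]] := nested g_valid fg fg' y1 y2;
      split; rewrite ltNge; apply/negP => bad; move: sf sf' Le Lb; rewrite /span; lra.
  by have [z1 z2] := newer_contains v bh a c; rewrite z1 z2.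
by move/(_ [::] g erefl).
Qed.

(** Every arrival with span at least [L] holds some base, and the hulls are disjoint. With [H] the
    integral of [flows] over one hull, a group costs at most
    [6 * (2 * H + 3/4 * 8 * H) = 48 * H]. *)
Theorem level_bound :
  \sum_(e <- g | ~~ (span e < L)) edge_len e <= 48%:R * total flows.
Proof.
have pos e : 0 <= edge_len e by exact: normr_ge0.
apply: (@le_trans _ _ (\sum_(b <- bases L g) \sum_(e <- g | holds b e) edge_len e)).
  rewrite (exchange_big_dep xpredT) //= big_mkcond !big_seq; apply: ler_sum => e eg.
  rewrite -leNgt; case: (leP L (span e)) => Le; last by apply: sumr_ge0 => ? _; exact: pos.
  have /hasP[b bb he] := has_base eg Le.
  by rewrite (big_rem b) //= he lerDl; apply: sumr_ge0 => ? _; exact: pos.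
apply: (@le_trans _ _ (\sum_(b <- bases L g) 48%:R * total (fun x => (hull b x)%:R * flows x))).
  rewrite !big_seq; apply: ler_sum => b bb; rewrite (bigID (@goes_left R)) /=.
  have := left_group_bound bb; have := right_group_bound bb; have := sweeps_le_hull bb.
  have Lp := L_gt0; rewrite natrD; lra.
rewrite -mulr_sumr ler_pM2l // -total_sum; apply: le_total_fun => x _.
by rewrite -mulr_suml ler_piMl ?flows_ge0 ?hull_unique.
Qed.

End Level.

(** * The total length of the online edges *)

Section TotalLength.
Variable R : realType.
Implicit Types (e : entry R) (h : seq (entry R)) (q : seq (R * R)) (T pts : seq R).

Local Notation rho := (rho R).

(* With f and c the lengths of the parts of the path from r to s where a further
   unit of flow costs and saves, respectively, this is f - rho * c. *)
Definition move_cost q (r s : R) : R :=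
  ((1 - rho) * `|r - s| + (1 + rho) * (sorted_cost ((r, s) :: q) - sorted_cost q)) / 2%:R.

Lemma left_rate_norm (d : int) :
  (1 + rho) * (`|d - 1|%:~R - `|d|%:~R) = 2%:R * left_rate R d - (1 - rho).
Proof.
rewrite /left_rate /rho -rmorphB; case: ifP => d0.
  by rewrite (_ : `|d - 1| - `|d| = 1); [rewrite mulr1; lra|lia].
by rewrite (_ : `|d - 1| - `|d| = -1); [rewrite mulrN1; lra|lia].
Qed.

Lemma right_rate_norm (d : int) :
  (1 + rho) * (`|d + 1|%:~R - `|d|%:~R) = 2%:R * right_rate R d - (1 - rho).
Proof.
rewrite /right_rate /rho -rmorphB; case: ifP => d0.
  by rewrite (_ : `|d + 1| - `|d| = 1); [rewrite mulr1; lra|lia].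
by rewrite (_ : `|d + 1| - `|d| = -1); [rewrite mulrN1; lra|lia].
Qed.

Section FixedPartition.
Variables (pts T : seq R).
Hypothesis pts_uniq : uniq pts.
Hypothesis T_pts : {subset T <= pts}.

Lemma move_cost_total q r s : r \in pts -> s \in pts ->
  (forall p, p \in q -> p.1 \in pts /\ p.2 \in pts) ->
  move_cost q r s = ((1 - rho) * `|r - s| + total pts (fun x =>
    (1 + rho) * (`|net ((r, s) :: q) x|%:~R - `|net q x|%:~R))) / 2%:R.
Proof.
move=> rp sp qp; rewrite /move_cost !(@sorted_cost_total _ pts) //; last first.
  by move=> p; rewrite inE => /orP[/eqP->|/qp].
congr (_ / _); congr (_ + _); rewrite totalZ; congr (_ * _).
rewrite -[- total _ _]mulN1r -totalZ -totalD; apply: total_eq => x _; by rewrite mulN1r.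
Qed.

Lemma net_cons p q x : net (p :: q) x = net [:: p] x + net q x.
Proof. by rewrite /net !big_cons big_nil addr0. Qed.

Lemma move_cost_left h r s : r \in pts -> s \in pts ->
  (forall p, p \in map (@edge R) h -> p.1 \in pts /\ p.2 \in pts) -> s <= r ->
  move_cost (map (@edge R) h) r s = left_cost pts h s r.
Proof.
move=> rp sp hp sr; rewrite move_cost_total // ger0_norm ?subr_ge0 //.
have -> : total pts (fun x => (1 + rho) * (`|net ((r, s) :: map (@edge R) h) x|%:~R -
    `|net (map (@edge R) h) x|%:~R)) =
    integral pts s r (fun x => 2%:R * left_rate R (flow h x) + (- (1 - rho)) * 1).
  rewrite integral_total; apply: total_eq => x _; rewrite net_cons -/(flow h x).
  rewrite /net big_seq1 /=.
  case: (leP s x) => sx; case: (ltP x r) => xr /=.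
  - by rewrite mul1r mulr1 sub0r [- _ + _]addrC left_rate_norm.
  - by rewrite subrr add0r subrr mulr0 mul0r.
  - by rewrite subrr add0r subrr mulr0 mul0r.
  - by move: (lt_le_trans sx sr); rewrite ltNge xr.
rewrite integralD !integralZ integral1 // /left_cost; lra.
Qed.

Lemma move_cost_right h r s : r \in pts -> s \in pts ->
  (forall p, p \in map (@edge R) h -> p.1 \in pts /\ p.2 \in pts) -> r <= s ->
  move_cost (map (@edge R) h) r s = right_cost pts h r s.
Proof.
move=> rp sp hp rs; rewrite move_cost_total // distrC ger0_norm ?subr_ge0 //.
have -> : total pts (fun x => (1 + rho) * (`|net ((r, s) :: map (@edge R) h) x|%:~R -
    `|net (map (@edge R) h) x|%:~R)) =
    integral pts r s (fun x => 2%:R * right_rate R (flow h x) + (- (1 - rho)) * 1).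
  rewrite integral_total; apply: total_eq => x _; rewrite net_cons -/(flow h x).
  rewrite /net big_seq1 /=.
  case: (leP r x) => sx; case: (ltP x s) => xr /=.
  - by rewrite mul1r mulr1 subr0 [1%:Z + _]addrC right_rate_norm.
  - by rewrite subrr add0r subrr mulr0 mul0r.
  - by rewrite subrr add0r subrr mulr0 mul0r.
  - by move: (lt_le_trans sx rs); rewrite ltNge xr.
rewrite integralD !integralZ integral1 // /right_cost; lra.
Qed.

Lemma potential_lipschitz (Y : R -> R) r s : r \in pts -> s \in pts ->
  (forall x, x \in pts -> `|Y (next_pt pts x) - Y x| <= width pts x) ->
  Y r - Y s <= `|r - s|.
Proof.
move=> rp sp YL; have [rs|/ltW sr] := leP r s.
  rewrite distrC ger0_norm ?subr_ge0 // -opprB -(telescope_pts pts_uniq Y rp sp rs).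
  rewrite -(telescope_pts pts_uniq id rp sp rs) -sumrN !(big_seq_cond (fun x => _ <= x < _)).
  by apply: ler_sum => x /andP[xp _]; have /ler_normlP[] := YL x xp.
rewrite ger0_norm ?subr_ge0 // -(telescope_pts pts_uniq Y sp rp sr).
rewrite -(telescope_pts pts_uniq id sp rp sr) !(big_seq_cond (fun x => _ <= x < _)).
by apply: ler_sum => x /andP[xp _]; have /ler_normlP[] := YL x xp.
Qed.

(** Weak duality: each pair contributes at most its length because [Y] is 1-Lipschitz, and servers
    outside [q] enter with nonpositive sign. *)
Lemma dual_bound_matching h q : uniq T -> {subset map (@request R) h <= pts} ->
  perm_eq (unzip1 q) (map (@request R) h) -> uniq (unzip2 q) -> {subset unzip2 q <= T} ->
  dual_bound pts T (\sum_(p <- q) `|p.1 - p.2|) h.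
Proof.
move=> Tu hp qh qu qT Y Y0 YL.
rewrite -(big_map (@request R) xpredT Y) -(perm_big _ qh) /= big_map.
apply: (@le_trans _ _ (\sum_(p <- q) Y p.1 - \sum_(p <- q) Y p.2)).
  rewrite lerD2l lerN2 -(big_map snd xpredT Y) -/(unzip2 q).
  rewrite [leRHS](bigID (fun s => s \in unzip2 q)) /= -[leLHS]addr0 lerD //.
    rewrite le_eqVlt; apply/orP; left; apply/eqP; rewrite -[RHS]big_filter.
    apply: perm_big; apply: uniq_perm; rewrite ?filter_uniq // => s.
    by rewrite mem_filter; case: (boolP (s \in _)) => // /qT.
  by rewrite big_seq_cond; apply: sumr_ge0 => s /andP[/T_pts sT _]; exact: Y0.
rewrite -sumrB !big_seq; apply: ler_sum => p pq.
apply: potential_lipschitz YL; last by apply: T_pts; apply: qT; exact: map_f.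
by apply: hp; rewrite -(perm_mem qh); exact: map_f.
Qed.

End FixedPartition.

(** [step_ok] with costs that do not refer to a partition, so that a single run can be analysed on
    the grids of all [L], which contain the quarter points needed for sweeps. *)
Definition greedy_step T h e : Prop :=
  [/\ left_free e \in free T h /\ right_free e \in free T h,
      between e,
      forall s, s \in free T h -> s <= left_free e \/ right_free e <= s &
      choice_ok (goes_left e)
        (move_cost (map (@edge R) h) (request e) (left_free e))
        (move_cost (map (@edge R) h) (request e) (right_free e))
        (request e - left_free e) (right_free e - request e)].

Fixpoint greedy_run T h : Prop :=
  if h is e :: h' then greedy_step T h' e /\ greedy_run T h' else True.

Lemma greedy_edge T pts h : {subset T <= pts} -> {subset map (@request R) h <= pts} ->
  greedy_run T h -> forall p, p \in map (@edge R) h -> p.1 \in pts /\ p.2 \in pts.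
Proof.
move=> Tp; elim: h => //= e h IH hp [[[lF rF] _ _ _] v] p; rewrite inE => /orP[/eqP->|].
  split; first by apply: hp; rewrite inE eqxx.
  by rewrite /= /server; case: ifP => _; apply: Tp; [exact: free_sub lF|exact: free_sub rF].
by apply: IH v p => x xh; apply: hp; rewrite inE xh orbT.
Qed.

Lemma greedy_valid T pts h : uniq pts -> {subset T <= pts} ->
  {subset map (@request R) h <= pts} -> greedy_run T h -> valid pts T h.
Proof.
move=> up Tp; elim: h => //= e h IH hp [st v].
have hp' : {subset map (@request R) h <= pts} by move=> x xh; apply: hp; rewrite inE xh orbT.
split; last exact: IH.
have [[lF rF] bt near ch] := st; have /andP[/ltW lr /ltW rr] := bt.
have rp : request e \in pts by apply: hp; rewrite inE eqxx.
have hE := greedy_edge Tp hp' v.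
split=> //; move: ch; rewrite (move_cost_left up) ?(move_cost_right up) //.
- exact: Tp (free_sub rF).
- exact: Tp (free_sub lF).
Qed.

Section Bound.
Variables (T : seq R) (h : seq (entry R)) (q : seq (R * R)).
Hypothesis T_uniq : uniq T.
Hypothesis h_run : greedy_run T h.
Hypothesis q_perm : perm_eq (unzip1 q) (map (@request R) h).
Hypothesis q_uniq : uniq (unzip2 q).
Hypothesis q_T : {subset unzip2 q <= T}.

Let O : R := \sum_(p <- q) `|p.1 - p.2|.

Definition grid (L : R) := undup (T ++ map (@request R) h ++
  map (fun e => left_free e + L / 4%:R) h ++ map (fun e => right_free e - L / 4%:R) h).

Lemma gridP L : [/\ uniq (grid L), {subset T <= grid L}, {subset map (@request R) h <= grid L} &
  forall e, e \in h -> left_free e + L / 4%:R \in grid L /\ right_free e - L / 4%:R \in grid L].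
Proof.
split; rewrite ?undup_uniq //.
- by move=> x xT; rewrite mem_undup mem_cat xT.
- by move=> x xT; rewrite mem_undup !mem_cat xT orbT.
move=> e eh; rewrite !mem_undup !mem_cat; split.
  by rewrite (map_f (fun e => left_free e + L / 4%:R) eh) !orbT.
by rewrite (map_f (fun e => right_free e - L / 4%:R) eh) !orbT.
Qed.

Lemma grid_valid L : valid (grid L) T h /\ dual_bound (grid L) T O h.
Proof.
have [gu gT gr _] := gridP L.
by split; [exact: greedy_valid gu gT gr h_run|exact: dual_bound_matching].
Qed.

Lemma sorted_cost_le : rho * sorted_cost (map (@edge R) h) <= O.
Proof.
have [gu gT gr _] := gridP 0; have [v db] := grid_valid 0.
by rewrite (sorted_cost_total gu (greedy_edge gT gr h_run)); exact: flow_le_dual v db.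
Qed.

(** [level_bound] for the run restricted to spans below [3L/2]. Each of the two flows integrates to
    at most [24 * O], and [2304 = 48 * (24 + 24)]. *)
Lemma sum_spans_step L : 0 < L ->
  \sum_(e <- h | span e < 3%:R / 2%:R * L) edge_len e <=
  \sum_(e <- h | span e < L) edge_len e + 2304%:R * O.
Proof.
move=> L0; have [gu gT gr gg] := gridP L; have [v db] := grid_valid L.
have vg := valid_filter_span (3%:R / 2%:R * L) v.
set g := [seq e <- h | span e < 3%:R / 2%:R * L] in vg.
have gs e : e \in g -> span e < 3%:R / 2%:R * L by rewrite mem_filter => /andP[].
have g4 e : e \in g -> left_free e + L / 4%:R \in grid L /\ right_free e - L / 4%:R \in grid L.
  by rewrite mem_filter => /andP[_ /gg].
have dg : dual_bound (grid L) T O g by exact: dual_bound_filter v db.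
have := level_bound gu gT L0 vg gs g4.
have A := flow_le_dual gu T_uniq gT vg dg.
have B := flow_le_dual gu T_uniq gT (valid_filter_span L vg) (dual_bound_filter _ vg dg).
rewrite /flows totalD -/(small L g) => C.
rewrite -big_filter -/g (bigID (fun e => span e < L)) /=.
have D : \sum_(e <- g | span e < L) edge_len e <= \sum_(e <- h | span e < L) edge_len e.
  rewrite [leLHS]big_filter_cond /= [leLHS]big_mkcond [leRHS]big_mkcond.
  by apply: ler_sum => e _; case: (span e < L); rewrite ?andbT ?andbF //; case: ifP => // _; exact: normr_ge0.
move: A B C D; rewrite /rho /small; lra.
Qed.

(** With [n = size h], edges of span below [O / n] have total length at most [O]. The [k] levels
    then lead beyond [1200 * O], twice the bound of [edge_len_le_dual], where [sum_large_spans]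
    allows only [(24 + 24) * O] more; so [49 = 1 + 48]. *)
Theorem sum_edge_len_le (k : nat) : (0 < size h)%N -> 0 < O ->
  1201%:R * (size h)%:R <= (3%:R / 2%:R) ^+ k :> R ->
  \sum_(e <- h) edge_len e <= (49%:R + 2304%:R * k%:R) * O.
Proof.
move=> n0 O0 hk; have [v db] := grid_valid 0; have [gu gT gr _] := gridP 0.
have nR : 0 < (size h)%:R :> R by rewrite ltr0n.
have len_span e : e \in h -> edge_len e <= span e.
  move=> /(valid_between v) /andP[/ltW lr /ltW rr]; rewrite /edge_len /span /server.
  by case: ifP => _; [|rewrite distrC]; rewrite ger0_norm ?subr_ge0 // lerB.
pose L j : R := O / (size h)%:R * (3%:R / 2%:R) ^+ j.
have L0 j : 0 < L j by rewrite mulr_gt0 ?divr_gt0 // exprn_gt0 //; lra.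
have low j : \sum_(e <- h | span e < L j) edge_len e <= (1 + 2304%:R * j%:R) * O.
  elim: j => [|j IH].
    apply: (@le_trans _ _ (\sum_(e <- h) O / (size h)%:R)).
      rewrite big_mkcond !big_seq; apply: ler_sum => e eh; case: ifP => sL.
        by apply: le_trans (len_span e eh) _; move: sL; rewrite /L expr0 mulr1 => /ltW.
      by rewrite divr_ge0 // ltW.
    rewrite big_const_seq count_predT iter_addr_0 -[leLHS]mulr_natr divfK ?gt_eqF //.
    by rewrite mulr0 addr0 mul1r.
  have := sum_spans_step (L0 j).
  have -> : 3%:R / 2%:R * L j = L j.+1 by rewrite /L exprS; ring.
  by move: IH; rewrite -natr1; lra.
rewrite (bigID (fun e => span e < L k)) /=.
have far : 2%:R * (600%:R * O) < L k.
  apply: (@lt_le_trans _ _ (1201%:R * O)); first by lra.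
  rewrite /L mulrAC -mulrA mulrC ler_pM2l // ler_pdivlMr //.
have := sum_large_spans gu gT v (fun e => edge_len_le_dual gu T_uniq gT v db) far.
have A := flow_le_dual gu T_uniq gT v db.
have B := flow_le_dual gu T_uniq gT (valid_filter_span (L k) v) (dual_bound_filter _ v db).
move: A B (low k); rewrite /rho; lra.
Qed.

End Bound.
End TotalLength.

(** * The online choice of servers *)

Section OnlineChoice.
Variable R : realType.
Implicit Types (h : seq (entry R)) (q : seq (R * R)) (S rs : seq R).

Local Notation rho := (rho R).

Definition available S q := [seq s <- S | s \notin unzip2 q].
Definition left_candidates S q (r : R) := [seq s <- available S q | s < r].
Definition right_candidates S q (r : R) := [seq s <- available S q | r < s].
(** The default [d] is the value when no free server lies on this side: 0 in the algorithm, which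
    then does not go there, and a sentinel in the analysis. *)
Definition next_left d S q r : R := last d (sort <=%R (left_candidates S q r)).
Definition next_right d S q r : R := head d (sort <=%R (right_candidates S q r)).

Definition choose_left S q r : bool :=
  let u := next_left 0 S q r in
  let v := next_right 0 S q r in
  if left_candidates S q r == [::] then false
  else if right_candidates S q r == [::] then true
  else if r - u <= v - r then rho * move_cost q r u <= move_cost q r v
  else ~~ (rho * move_cost q r v <= move_cost q r u).

Definition next_server S q r : R :=
  if choose_left S q r then next_left 0 S q r else next_right 0 S q r.

Definition online_pairs S rs : seq (R * R) :=
  foldl (fun q r => (r, next_server S q r) :: q) [::] rs.

Lemma online_pairs_rcons S rs r : online_pairs S (rcons rs r) =
  (r, next_server S (online_pairs S rs) r) :: online_pairs S rs.
Proof. by rewrite /online_pairs foldl_rcons. Qed.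

Lemma unzip1_online_pairs S rs : unzip1 (online_pairs S rs) = rev rs.
Proof. by elim/last_ind: rs => // rs r IH; rewrite online_pairs_rcons /= IH rev_rcons. Qed.

Lemma size_online_pairs S rs : size (online_pairs S rs) = size rs.
Proof. by rewrite -(size_map fst) -/(unzip1 _) unzip1_online_pairs size_rev. Qed.

Lemma last_sort d (s : seq R) :
  (s != [::] -> last d (sort <=%R s) \in s) /\ forall x, x \in s -> x <= last d (sort <=%R s).
Proof.
have ss : sorted <=%R (sort <=%R s) by exact/sort_sorted/le_total.
split=> [|x].
  by rewrite -size_eq0 -(size_sort <=%R) -(mem_sort <=%R); case: (sort _ _) => //= a t _; exact: mem_last.
rewrite -(mem_sort <=%R); case: (sort _ _) ss => // a t /= pt.
rewrite inE => /orP[/eqP->|xt].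
  by have /allP := order_path_min le_trans pt; case: t pt => //= b t _; apply; exact: mem_last.
case/splitPr: xt pt => t1 t2; rewrite cat_path last_cat /= => /and3P[_ _ pt].
by have /allP := order_path_min le_trans pt; case: t2 pt => //= b t2 _; apply; exact: mem_last.
Qed.

Lemma head_sort d (s : seq R) :
  (s != [::] -> head d (sort <=%R s) \in s) /\ forall x, x \in s -> head d (sort <=%R s) <= x.
Proof.
have ss : sorted <=%R (sort <=%R s) by exact/sort_sorted/le_total.
split=> [|x].
  rewrite -size_eq0 -(size_sort <=%R) -(mem_sort <=%R); case: (sort _ _) => //= a t _.
  by rewrite inE eqxx.
rewrite -(mem_sort <=%R); case: (sort _ _) ss => // a t /= pt.
rewrite inE => /orP[/eqP->//|xt].
by have /allP := order_path_min le_trans pt; exact.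
Qed.

Lemma sorted_cost_ge q (M w : R) : (forall p, p \in q -> `|p.1| <= M) ->
  w \in unzip2 q -> `|w| - M <= sorted_cost q.
Proof.
move=> qM wq; rewrite /sorted_cost /cost; set a := sort _ _; set b := sort _ _.
have sab : size a = size b by rewrite !size_sort !size_map.
have /(nthP 0)[i ib iw] : w \in b by rewrite mem_sort.
have ia : (i < size a)%N by rewrite sab.
rewrite (bigD1 (Ordinal ia)) //= iw.
have : a`_i \in a by rewrite mem_nth.
rewrite mem_sort => /mapP[p pq ->].
apply: (@le_trans _ _ `|p.1 - w|); last by rewrite lerDl sumr_ge0.
rewrite distrC; apply: le_trans (lerB_dist _ _).
by have := qM p pq; lra.
Qed.

Lemma sorted_cost_bounded q (M : R) : (forall p, p \in q -> `|p.1| <= M /\ `|p.2| <= M) ->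
  sorted_cost q <= (size q)%:R * (2%:R * M).
Proof.
move=> qM; rewrite /sorted_cost /cost; set a := sort _ _; set b := sort _ _.
have sab : size a = size b by rewrite !size_sort !size_map.
have <- : size a = size q by rewrite size_sort size_map.
rewrite mulr_natl.
apply: (@le_trans _ _ (\sum_(i < size a) 2%:R * M)); last by rewrite sumr_const card_ord.
apply: ler_sum => i _.
have : a`_i \in a by rewrite mem_nth.
rewrite mem_sort => /mapP[p pq ->].
have : b`_i \in b by rewrite mem_nth // -sab.
rewrite mem_sort => /mapP[p' pq' ->].
apply: le_trans (ler_normB _ _) _.
by have := (qM _ pq).1; have := (qM _ pq').2; lra.
Qed.

Lemma greedy_nonneg T h r u : uniq T -> greedy_run T h -> u \in free T h ->
  0 <= move_cost (map (@edge R) h) r u.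
Proof.
move=> Tu hr uF; pose pts := undup (r :: T ++ map (@request R) h).
have pu : uniq pts by exact: undup_uniq.
have Tp : {subset T <= pts} by move=> x xT; rewrite mem_undup inE mem_cat xT orbT.
have hp : {subset map (@request R) h <= pts}.
  by move=> x xh; rewrite mem_undup inE mem_cat xh !orbT.
have rp : r \in pts by rewrite mem_undup inE eqxx.
have up : u \in pts by apply: Tp; exact: free_sub uF.
have v := greedy_valid pu Tp hp hr; have hE := greedy_edge Tp hp hr.
have [A B] := valid_nonneg Tp v uF rp.
by case: (leP u r) => [ur|/ltW ru]; [rewrite (move_cost_left pu)|rewrite (move_cost_right pu)]; auto.
Qed.

Section Sentinels.
Variables (S : seq R) (M W : R) (N : nat).
Hypothesis S_uniq : uniq S.
Hypothesis S_bound : forall s, s \in S -> `|s| <= M.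
Hypothesis M_gt0 : 0 < M.
Hypothesis W_large : 20%:R * (N.+1%:R * M) <= W.

(* Two far servers, never used, so that every request has free neighbours. *)
Let T := - W :: W :: S.

Definition next_entry q r : entry R :=
  (r, (next_left (- W) S q r, next_right W S q r), choose_left S q r).

Definition entries rs : seq (entry R) :=
  foldl (fun h r => next_entry (map (@edge R) h) r :: h) [::] rs.

Lemma entries_rcons rs r :
  entries (rcons rs r) = next_entry (map (@edge R) (entries rs)) r :: entries rs.
Proof. by rewrite /entries foldl_rcons. Qed.

Lemma bound_lt_sentinel : M < W.
Proof.
have := M_gt0; have := W_large; have : 0 <= N%:R * M by rewrite mulr_ge0 // ltW.
by rewrite -[N.+1%:R]natr1; lra.
Qed.

Lemma sentinels_uniq : uniq T.
Proof.
have MW := bound_lt_sentinel; have M0 := M_gt0.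
rewrite /T /= S_uniq andbT inE negb_or -andbA; apply/and3P; split; first by apply/eqP; lra.
  by apply/negP => /S_bound; rewrite normrN; have := ler_norm W; lra.
by apply/negP => /S_bound; have := ler_norm W; lra.
Qed.

Definition good_state rs h :=
  [/\ greedy_run T h, map (@edge R) h = online_pairs S rs &
      {subset map (@server R) h <= S}].

(** Both the distance to [w] and the new optimal cost are at least [W - M]. Together with
    [candidate_cost], a real server costs at most [1 / rho] times a sentinel, so [choice_ok] permits
    it when the other side is empty. *)
Lemma sentinel_cost q r w : (forall p, p \in q -> `|p.1| <= M /\ `|p.2| <= M) ->
  (size q <= N)%N -> `|r| <= M -> `|w| = W ->
  2%:R * (N.+1%:R * M) <= move_cost q r w.
Proof.
move=> qM sq rM wW; rewrite /move_cost.
have M0 := M_gt0; have WL := W_large.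
have sN : (size q)%:R * (2%:R * M) <= N%:R * (2%:R * M).
  by rewrite ler_pM2r ?ler_nat // mulr_gt0.
have B := le_trans (sorted_cost_bounded qM) sN.
have A : W - M <= `|r - w|.
  by rewrite -wW distrC; apply: le_trans (lerB_dist _ _); lra.
have C : `|w| - M <= sorted_cost ((r, w) :: q).
  apply: sorted_cost_ge; last by rewrite inE eqxx.
  by move=> p; rewrite inE => /orP[/eqP->//|/qM[]].
have NM : 0 <= N%:R * M by rewrite mulr_ge0 // ltW.
by move: B C WL; rewrite wW -[N.+1%:R]natr1 /rho; lra.
Qed.

Lemma candidate_cost q r s : (forall p, p \in q -> `|p.1| <= M /\ `|p.2| <= M) ->
  (size q <= N)%N -> `|r| <= M -> `|s| <= M ->
  rho * move_cost q r s <= 2%:R * (N.+1%:R * M).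
Proof.
move=> qM sq rM sM; rewrite /move_cost.
have M0 := M_gt0.
have sN : (size q).+1%:R * (2%:R * M) <= N.+1%:R * (2%:R * M).
  by rewrite ler_pM2r ?ler_nat // mulr_gt0.
have B : sorted_cost ((r, s) :: q) <= N.+1%:R * (2%:R * M).
  apply: le_trans sN; apply: (@sorted_cost_bounded ((r, s) :: q)) => p.
  by rewrite inE => /orP[/eqP->//|/qM].
have A : `|r - s| <= M + M by apply: le_trans (ler_normB _ _) _; rewrite lerD.
have C : 0 <= sorted_cost q by apply: sumr_ge0.
have NM : 0 <= N%:R * M by rewrite mulr_ge0 // ltW.
by move: A B C; rewrite -[N.+1%:R]natr1 /rho; lra.
Qed.

(** The analysed run has sentinels and the algorithm has none, yet both choose alike: a sentinel
    replaces an empty side only, and as fewer requests have come than there are servers, the other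
    side is then nonempty. *)
Lemma good_entries rs : (size rs <= size S)%N -> (size rs <= N)%N ->
  (forall r, r \in rs -> `|r| <= M /\ r \notin S) -> good_state rs (entries rs).
Proof.
have M0 := M_gt0; have MW := bound_lt_sentinel; have WL := W_large.
elim/last_ind: rs => [|rs r IH] sS sN rsM; first by split.
rewrite size_rcons in sS sN.
have [|||hr hE hS] := IH; [exact: ltnW|exact: ltnW| |].
  by move=> x xr; apply: rsM; rewrite mem_rcons inE xr orbT.
have [rM rS] : `|r| <= M /\ r \notin S by apply: rsM; rewrite mem_rcons inE eqxx.
rewrite /good_state entries_rcons online_pairs_rcons hE.
set h := entries rs in hr hE hS *; set q := online_pairs S rs in hE *.
have qs : unzip2 q = map (@server R) h by rewrite -hE /unzip2 -map_comp.
have qM p : p \in q -> `|p.1| <= M /\ `|p.2| <= M.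
  move=> pq; split.
    have : p.1 \in unzip1 q by exact: map_f.
    rewrite unzip1_online_pairs mem_rev => pr.
    by have [] := rsM p.1; rewrite // mem_rcons inE pr orbT.
  by apply: S_bound; apply: hS; rewrite -qs; exact: map_f.
have sq : size q = size rs by exact: size_online_pairs.
have avE s : (s \in available S q) = (s \in S) && (s \in free T h).
  rewrite !mem_filter qs andbC; case: (boolP (s \in S)) => //= sS'.
  by rewrite /T !inE sS' !orbT andbT.
have W_used w : `|w| = W -> w \notin map (@server R) h.
  by move=> wW; apply/negP => /hS/S_bound; rewrite wW leNgt MW.
have nW : `|- W| = W by rewrite normrN ger0_norm // ltW // (lt_trans M0).
have pW : `|W| = W by rewrite ger0_norm // ltW // (lt_trans M0).
have [/ler_normlP[rM1 rM2]] := rM.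
have lW : - W \in free T h by rewrite mem_filter W_used //= /T inE eqxx.
have rW : W \in free T h by rewrite mem_filter W_used //= /T !inE eqxx orbT.
have lc s : s \in left_candidates S q r -> [/\ s \in S, s \in free T h & s < r].
  by rewrite mem_filter avE => /and3P[].
have rc s : s \in right_candidates S q r -> [/\ s \in S, s \in free T h & r < s].
  by rewrite mem_filter avE => /and3P[].
set e := next_entry q r.
have lE : (left_candidates S q r == [::] /\ left_free e = - W) \/
    [/\ left_candidates S q r != [::], left_free e = next_left 0 S q r &
        left_free e \in left_candidates S q r].
  rewrite /left_free /= /next_left; case: eqP => [->|/eqP n0]; first by left.
  right; split=> //; last exact: (last_sort _ _).1 n0.
  by move: n0; rewrite -size_eq0 -(size_sort <=%R); case: (sort _ _).
have rE : (right_candidates S q r == [::] /\ right_free e = W) \/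
    [/\ right_candidates S q r != [::], right_free e = next_right 0 S q r &
        right_free e \in right_candidates S q r].
  rewrite /right_free /= /next_right; case: eqP => [->|/eqP n0]; first by left.
  right; split=> //; last exact: (head_sort _ _).1 n0.
  by move: n0; rewrite -size_eq0 -(size_sort <=%R); case: (sort _ _).
have [lF lr] : left_free e \in free T h /\ left_free e < r.
  case: lE => [[_ ->]|[_ _ /lc[]]] //; split=> //; lra.
have [rF rr] : right_free e \in free T h /\ r < right_free e.
  case: rE => [[_ ->]|[_ _ /rc[]]] //; split=> //; lra.
have near s : s \in free T h -> s <= left_free e \/ right_free e <= s.
  rewrite mem_filter /T !inE => /andP[sh /or3P[/eqP->|/eqP->|sS']].
  - left; case: lE => [[_ ->]//|[_ _ /lc[/S_bound]]] /ler_normlP[A B] _ _; lra.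
  - right; case: rE => [[_ ->]//|[_ _ /rc[/S_bound]]] /ler_normlP[A B] _ _; lra.
  have sa : s \in available S q by rewrite mem_filter qs sh.
  have [sr|rs'|sr] := ltgtP s r; last by move: rS; rewrite -sr sS'.
    by left; apply: (last_sort _ _).2; rewrite mem_filter sr.
  by right; apply: (head_sort _ _).2; rewrite mem_filter rs'.
have some_free : (left_candidates S q r != [::]) || (right_candidates S q r != [::]).
  have [s sS' su] : exists2 s, s \in S & s \notin unzip2 q.
    apply/hasP; rewrite has_predC; apply/negP => /allP sub.
    have := uniq_leq_size S_uniq sub; rewrite size_map sq leqNgt sS; by [].
  have sa : s \in available S q by rewrite mem_filter su.
  have [sr|rs'|sr] := ltgtP s r; last by move: rS; rewrite -sr sS'.
    by apply/orP; left; apply/eqP => l0; have := in_nil s; rewrite -l0 mem_filter sr sa.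
  by apply/orP; right; apply/eqP => l0; have := in_nil s; rewrite -l0 mem_filter rs' sa.
have sqN : (size q <= N)%N by rewrite sq ltnW.
have rho0 := rho_gt0 R.
have ch : choice_ok (choose_left S q r)
    (move_cost q r (left_free e)) (move_cost q r (right_free e))
    (r - left_free e) (right_free e - r).
  have Lpos : 0 <= move_cost q r (left_free e) by rewrite -hE; exact: greedy_nonneg sentinels_uniq hr lF.
  have Rpos : 0 <= move_cost q r (right_free e) by rewrite -hE; exact: greedy_nonneg sentinels_uniq hr rF.
  case: lE rE some_free => [[/eqP l0 eL]|[l0 eL /lc[lS _ _]]] [[/eqP r0 eR]|[r0 eR /rc[rS' _ _]]];
    rewrite /choose_left ?l0 ?r0 ?(negbTE l0) ?(negbTE r0) ?eqxx //= => _.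
  - rewrite /toward_left; split.
      rewrite eL; apply: le_trans (sentinel_cost qM sqN rM nW).
      by apply: candidate_cost => //; exact: S_bound.
    left; move: (S_bound rS') => /ler_normlP[A B]; rewrite eL.
    have : 0 <= N%:R * M by rewrite mulr_ge0 // ltW.
    by move: WL; rewrite -[N.+1%:R]natr1; lra.
  - rewrite /toward_left; split.
      rewrite eR; apply: le_trans (sentinel_cost qM sqN rM pW).
      by apply: candidate_cost => //; exact: S_bound.
    left; move: (S_bound lS) => /ler_normlP[A B]; rewrite eR.
    have : 0 <= N%:R * M by rewrite mulr_ge0 // ltW.
    by move: WL; rewrite -[N.+1%:R]natr1; lra.
  rewrite -eL -eR; set XL := move_cost _ _ _ in Lpos *; set XR := move_cost _ _ _ in Rpos *.
  (* When the farther server wins, its cost is below [rho] times the other one. Its [rho]-fold is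
     thus at most [rho * rho] times the other, nonnegative cost, which yields the first condition of
     [toward_left]. *)
  have sq_le X : 0 <= X -> rho * (rho * X) <= X.
    by move=> X0; rewrite mulrA; apply: ler_piMl => //; rewrite /rho; lra.
  case: (leP (r - left_free e) (right_free e - r)) => d /=.
    case: (leP (rho * XL) XR) => c; rewrite /choice_ok /toward_left; first by split=> //; left.
    split; last by right.
    by apply: le_trans (sq_le _ Lpos); rewrite ler_pM2l // ltW.
  case: (leP (rho * XR) XL) => c; rewrite /choice_ok /toward_left /=; first by split=> //; left; exact: ltW.
  split; last by right.
  by apply: le_trans (sq_le _ Rpos); rewrite ler_pM2l // ltW.
have sE : server e = next_server S q r.
  rewrite /server /next_server /goes_left /=.
  move: some_free ch; rewrite /choose_left.
  case: lE => [[/eqP-> _]|[n0 -> _]] /=.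
    by case: rE => [[/eqP-> _]|[_ -> _]].
  rewrite (negbTE n0); case: rE => [[/eqP-> _]|[n1 -> _]] /=; first by [].
  by rewrite (negbTE n1).
have sF : server e \in S.
  rewrite sE /next_server; move: some_free; rewrite /choose_left.
  have L1 : left_candidates S q r != [::] -> next_left 0 S q r \in S.
    by move=> n0; have [] := lc _ ((last_sort 0 _).1 n0).
  have R1 : right_candidates S q r != [::] -> next_right 0 S q r \in S.
    by move=> n0; have [] := rc _ ((head_sort 0 _).1 n0).
  case: eqP => [l0|/eqP l0] /=; first by rewrite ?l0 => /R1.
  by case: eqP => [r0|/eqP r0] _; [exact: L1|case: ifP => _; auto].
split.
- split=> //; split=> //; first by rewrite /between lr rr.
  by rewrite hE.
- by rewrite /= hE -sE.
- by move=> s; rewrite inE => /orP[/eqP->|/hS].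
Qed.

End Sentinels.
End OnlineChoice.

(** * Bounds for the online choice in terms of the optimum *)

Section OnlineBounds.
Variable R : realType.
Implicit Types (S : {fset R}) (rs : seq R).

Definition online_len (S : seq R) rs : R := \sum_(p <- online_pairs S rs) `|p.1 - p.2|.

Lemma cost_zip (rs M : seq R) : size rs = size M ->
  cost rs M = \sum_(p <- zip rs M) `|p.1 - p.2|.
Proof.
move=> sM; rewrite /cost (big_nth (0, 0)) size_zip -sM minnn big_mkord.
by apply: eq_bigr => i _; rewrite nth_zip.
Qed.

Lemma instance_take S rs k : instance S rs -> instance S (take k rs).
Proof.
move=> [sS pos]; split; first by rewrite (leq_trans _ sS) // size_take_min geq_minr.
by move=> r s /mem_take; exact: pos.
Qed.

Lemma opt_pos S rs : instance S rs -> (0 < size rs)%N -> 0 < opt S rs.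
Proof.
move=> [sS pos] s0; have [[M /and3P[/eqP sM _ /allP MS] ->] _] := opt_min sS.
rewrite /cost (bigD1 (Ordinal s0)) //= ltr_wpDr ?sumr_ge0 //.
by apply: pos; [exact: mem_nth|apply: MS; rewrite mem_nth // sM].
Qed.

Lemma opt_nil S : opt S [::] = 0.
Proof.
by have [[M _ ->] _] := @opt_min R S [::] (leq0n _); rewrite /cost big_ord0.
Qed.

Lemma cost_cat (r1 r2 m1 m2 : seq R) : size r1 = size m1 -> size r2 = size m2 ->
  cost (r1 ++ r2) (m1 ++ m2) = cost r1 m1 + cost r2 m2.
Proof. by move=> s1 s2; rewrite !cost_zip ?size_cat ?s1 ?s2 // zip_cat // big_cat. Qed.

Lemma cost_ge0 (rs M : seq R) : 0 <= cost rs M.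
Proof. by apply: sumr_ge0. Qed.

Lemma opt_take S rs k : instance S rs -> opt S (take k rs) <= opt S rs.
Proof.
move=> inst; have [[M /and3P[/eqP sM uM MS] ->] _] := opt_min inst.1.
have [_ le] := opt_min (instance_take k inst).1.
have st : size (take k M) = size (take k rs) by rewrite !size_take_min sM.
apply: le_trans (le (take k M) _) _.
  apply/and3P; split; rewrite ?st ?take_uniq //.
  by apply/allP => x /mem_take; move: x; exact/allP.
rewrite -[in leRHS](cat_take_drop k rs) -[in leRHS](cat_take_drop k M) cost_cat ?st //.
  by rewrite lerDl cost_ge0.
by rewrite !size_drop sM.
Qed.

Section OneInstance.
Variables (S : {fset R}) (rs : seq R).
Hypothesis inst : instance S rs.

Let M : R := 1 + \sum_(x <- (S : seq R) ++ rs) `|x|.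
Let N := size rs.
Let W : R := 20%:R * (N.+1%:R * M).
Let T := - W :: W :: (S : seq R).

Lemma coord_bound x : x \in (S : seq R) ++ rs -> `|x| <= M.
Proof.
move=> xs; rewrite /M (big_rem x xs) /= addrCA lerDl addr_ge0 ?ler01 //.
by rewrite sumr_ge0.
Qed.

Lemma bound_gt0 : 0 < M.
Proof. by rewrite ltr_wpDr ?ltr01 // sumr_ge0. Qed.

Lemma online_entries : exists h, [/\ uniq T, greedy_run T h,
  map (@edge R) h = online_pairs S rs & {subset map (@server R) h <= S}].
Proof.
have S_bound s : s \in (S : seq R) -> `|s| <= M.
  by move=> sS; apply: coord_bound; rewrite mem_cat sS.
have Tu : uniq T by apply: (@sentinels_uniq _ _ M W N); rewrite ?fset_uniq ?bound_gt0.
have [|||g e s] := @good_entries R S M W N (fset_uniq S) S_bound bound_gt0 (lexx _) rs.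
- exact: inst.1.
- by [].
- move=> r rrs; split; first by apply: coord_bound; rewrite mem_cat rrs orbT.
  by apply/negP => rS; have := inst.2 r r rrs rS; rewrite subrr normr0 ltxx.
by exists (entries S W rs).
Qed.

Lemma online_servers : uniq (unzip2 (online_pairs S rs)) /\
  {subset unzip2 (online_pairs S rs) <= S}.
Proof.
have [h [Tu hr hE hS]] := online_entries.
have -> : unzip2 (online_pairs S rs) = map (@server R) h by rewrite -hE /unzip2 -map_comp.
split=> //; have [gu gT gr _] := gridP T h 0.
exact: (used_uniq (greedy_valid gu gT gr hr)).1.
Qed.

Lemma online_optimum : exists h q, [/\ uniq T, greedy_run T h, map (@edge R) h = online_pairs S rs,
  [/\ perm_eq (unzip1 q) (map (@request R) h), uniq (unzip2 q) & {subset unzip2 q <= T}] &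
  opt S rs = \sum_(p <- q) `|p.1 - p.2|].
Proof.
have [h [Tu hr hE hS]] := online_entries.
have [[M0 /and3P[/eqP sM uM /allP MS] oE] _] := opt_min inst.1.
exists h, (zip rs M0); split=> //; last by rewrite oE cost_zip.
have -> : map (@request R) h = rev rs.
  by rewrite -(unzip1_online_pairs S) -hE /unzip1 -map_comp.
rewrite unzip1_zip ?sM // unzip2_zip ?sM //; split=> //; first by rewrite perm_sym perm_rev.
by move=> x /MS xS; rewrite /T !inE xS !orbT.
Qed.

Theorem online_cost_le : sorted_cost (online_pairs S rs) <= 24%:R * opt S rs.
Proof.
have [h [q [Tu hr hE [qp qu qT] ->]]] := online_optimum.
by have := sorted_cost_le Tu hr qp qu qT; rewrite hE /rho; lra.
Qed.

Theorem online_len_le k : (0 < size rs)%N ->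
  1201%:R * (size rs)%:R <= (3%:R / 2%:R) ^+ k :> R ->
  online_len S rs <= (49%:R + 2304%:R * k%:R) * opt S rs.
Proof.
move=> s0 hk; have [h [q [Tu hr hE [qp qu qT] oE]]] := online_optimum.
have sh : size h = size rs by rewrite -(size_map (@edge R)) hE size_online_pairs.
have := sum_edge_len_le Tu hr qp qu qT (k := k).
rewrite sh -oE opt_pos // => /(_ s0 isT hk); apply: le_trans.
by rewrite /online_len -hE big_map.
Qed.

End OneInstance.
End OnlineBounds.

(** * Rebuilding the matching *)

Section Rebuilding.
Variable R : realType.
Implicit Types (S : {fset R}) (rs : seq R).

Definition servers (S : seq R) rs : seq R := rev (unzip2 (online_pairs S rs)).

Lemma size_servers (S : seq R) rs : size (servers S rs) = size rs.
Proof. by rewrite size_rev size_map size_online_pairs. Qed.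

Lemma servers_rcons (S : seq R) rs r : servers S (rcons rs r) =
  rcons (servers S rs) (next_server S (online_pairs S rs) r).
Proof. by rewrite /servers online_pairs_rcons /= rev_cons. Qed.

Lemma take_servers (S : seq R) rs k : take k (servers S rs) = servers S (take k rs).
Proof.
elim/last_ind: rs => // rs r IH; rewrite servers_rcons.
have [kr|rk] := leqP k (size rs).
  by rewrite -!cats1 !takel_cat ?size_servers.
by rewrite !take_oversize ?size_rcons ?size_servers // servers_rcons.
Qed.

Lemma zip_servers (S : seq R) rs : zip rs (servers S rs) = rev (online_pairs S rs).
Proof.
have e : rs = rev (unzip1 (online_pairs S rs)) by rewrite unzip1_online_pairs revK.
by rewrite [X in zip X _]e /servers -rev_zip ?size_map // zip_unzip.
Qed.

(* The current matching, the index of the first request of the current phase,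
   the optimum when the phase started, and the total length of the online edges
   when the phase was last rebuilt. *)
Definition state : Type := (seq R * nat * R * R)%type.

(** [rs] ends with the request that has just arrived. The first request of an instance always opens
    a phase, since [B] starts at 0 and [opt] is then positive. *)
Definition step S rs (st : state) : state :=
  let: (M, a, B, W) := st in
  let s := last 0 (servers S rs) in
  if 2%:R * B < opt S rs then (rcons M s, size M, opt S rs, online_len S rs)
  else if B < online_len S rs - W then
    (take a M ++ rematch (drop a rs) (drop a (servers S rs)), a, B, online_len S rs)
  else (rcons M s, a, B, W).

Fixpoint run S rs t : state :=
  if t is t'.+1 then step S (take t rs) (run S rs t') else ([::], 0%N, 0, 0).

Definition matching (st : state) : seq R := st.1.1.1.

Lemma run_take S rs k t : (t <= k)%N -> run S (take k rs) t = run S rs t.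
Proof.
elim: t => //= t IH tk; rewrite IH ?(ltnW tk) //.
by rewrite take_takel.
Qed.

Definition changes (M M' : seq R) (t : nat) : nat := #|[set i : 'I_t | M`_i != M'`_i]%SET|.

Lemma changes_rcons (M : seq R) s : changes M (rcons M s) (size M) = 0%N.
Proof.
apply/eqP; rewrite cards_eq0; apply/eqP/setP => i; rewrite !inE nth_rcons ltn_ord.
by rewrite eqxx.
Qed.

Lemma changes_suffix (M M' : seq R) a t : (a <= t)%N ->
  (forall i, (i < a)%N -> M`_i = M'`_i) -> (changes M M' t <= t - a)%N.
Proof.
move=> at' eqM; rewrite /changes cardE -(size_map val) -(size_iota a (t - a)).
apply: uniq_leq_size; first by rewrite (map_inj_uniq val_inj) enum_uniq.
move=> x /mapP[i]; rewrite mem_enum inE => ne ->; rewrite mem_iota subnKC // ltn_ord andbT.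
by rewrite leqNgt; apply/negP => /eqM e; rewrite e eqxx in ne.
Qed.

Section OneInstance.
Variables (S : {fset R}) (rs : seq R) (kappa : R).
Hypothesis inst : instance S rs.
Hypothesis kappa_ge0 : 0 <= kappa.
Hypothesis len_le : forall t, (t <= size rs)%N ->
  online_len S (take t rs) <= kappa * opt S (take t rs).

Definition recourse t : nat := (\sum_(i < t)
  changes (matching (run S rs i)) (matching (run S rs i.+1)) i)%N.

(* The number x of rebuildings in the current phase is at most W / B. *)
Definition invariant t (st : state) : Prop :=
  let: (M, a, B, W) := st in
  let r := take t rs in
  [/\ [/\ size M = t, (a <= t)%N, perm_eq M (servers S r) & perm_eq (take a M) (servers S (take a rs))],
      [/\ (0 < t)%N -> 0 < B, B <= opt S r, opt S r <= 2%:R * B & opt S (take a rs) <= B],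
      [/\ 0 <= W, W <= online_len S r & online_len S r - W <= B],
      cost (take a r) (take a M) <= 73%:R * B /\
      cost (drop a r) (drop a M) <= 72%:R * B + (online_len S r - W) &
      exists x : nat, x%:R * B <= W /\
        (recourse t)%:R <= 2%:R * kappa * a%:R + (t - a)%:R * x%:R].

Lemma opt_mono t u : (t <= u)%N -> opt S (take t rs) <= opt S (take u rs).
Proof. by move=> tu; rewrite -(take_takel rs tu); apply: opt_take; exact: instance_take. Qed.

Lemma online_len_rcons (rs' : seq R) r : online_len S (rcons rs' r) =
  `|r - next_server S (online_pairs S rs') r| + online_len S rs'.
Proof. by rewrite /online_len online_pairs_rcons big_cons. Qed.

Lemma online_len_ge0 (rs' : seq R) : 0 <= online_len S rs'.
Proof. by apply: sumr_ge0. Qed.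

Lemma sorted_cost1 (r s : R) : sorted_cost [:: (r, s)] = `|r - s|.
Proof. by rewrite /sorted_cost /cost /= big_ord1. Qed.

Lemma cost_rcons (r m : seq R) x y : size r = size m ->
  cost (rcons r x) (rcons m y) = cost r m + `|x - y|.
Proof. by move=> s; rewrite -!cats1 cost_cat // [cost [:: x] _]big_ord1. Qed.

Lemma invariant_run t : (t <= size rs)%N -> invariant t (run S rs t).
Proof.
have run_size i : recourse i.+1 =
    (recourse i + changes (matching (run S rs i)) (matching (run S rs i.+1)) i)%N.
  by rewrite /recourse big_ord_recr.
elim: t => [_|t IH tn].
  rewrite /= /invariant take0 opt_nil /online_len /= big_nil mulr0; split.
  - by [].
  - by [].
  - by rewrite subrr !lexx.
  - by rewrite /cost !big_ord0 subrr addr0 !mulr0.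
  by exists 0%N; rewrite /recourse big_ord0 mul0r !mulr0 addr0.
have {IH} := IH (ltnW tn); rewrite [run _ _ t.+1]/=.
have := run_size t; rewrite [run _ _ t.+1]/=.
case: (run S rs t) => [[[M a] B] W] /= recE.
set r := take t rs; have rE : take t.+1 rs = rcons r rs`_t by exact: take_nth.
have sr : size r = t by rewrite size_takel // ltnW.
set r' := take t.+1 rs in rE recE *.
have sr' : size r' = t.+1 by rewrite size_takel.
set s := last 0 (servers S r') in recE *.
have sE : servers S r' = rcons (servers S r) s.
  by rewrite /s rE servers_rcons last_rcons.
have lE : online_len S r' = `|rs`_t - s| + online_len S r.
  by rewrite rE online_len_rcons /s rE servers_rcons last_rcons.
have pE : online_pairs S r' = (rs`_t, s) :: online_pairs S r.
  by rewrite rE online_pairs_rcons /s rE servers_rcons last_rcons.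
have inst' : instance S r' := instance_take t.+1 inst.
have instr : instance S r := instance_take t inst.
have o0 : 0 < opt S r' by apply: opt_pos; rewrite ?sr'.
have om : opt S r <= opt S r' by exact: opt_mono.
have cr := online_cost_le instr; have cr' := online_cost_le inst'.
have len' := len_le tn; rewrite -/r' in len'.
case=> -[sM at' pM pMa] [B0 Bo oB oa] [W0 Wl lW] [cP cQ] [x [xW rec]].
have sta : size (take a M) = a by rewrite size_takel // sM.
have str : size (take a r) = a by rewrite size_takel // sr.
have sd : size (drop a r) = size (drop a M) by rewrite !size_drop sM sr.
have tkr : take t r' = r by rewrite rE -cats1 take_size_cat.
have dkr : drop t r' = [:: rs`_t] by rewrite rE -cats1 drop_size_cat.
have aR : a%:R + (t - a)%:R = t%:R :> R by rewrite -natrD subnKC.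
have perm1 : perm_eq (rcons M s) (servers S r').
  by rewrite sE -!cats1 perm_cat2r.
case: ifP recE => [new|stay] recE.
  rewrite /invariant -/r' -/r; split.
  - by split; rewrite ?size_rcons ?sM // -cats1 take_size_cat.
  - by split; rewrite ?sM //; lra.
  - by rewrite online_len_ge0 lexx subrr ltW.
  - rewrite sM tkr dkr -cats1 take_size_cat // drop_size_cat //; split.
      (* The old phase is frozen at total cost at most [73 + 72 + 1 = 146] times the old [B]. This
         is below 73 times the new value, which exceeds [2 * B]. *)
      have -> : cost r M = cost (take a r) (take a M) + cost (drop a r) (drop a M).
        by rewrite -cost_cat ?cat_take_drop // str sta.
      lra.
    (* The first edge of a phase is the difference of two online flows, so its length is at most
       [24 * opt S r' + 24 * opt S r], within 72 times the new value. *)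
    rewrite [cost [:: _] _]big_ord1 /= subrr addr0 -sorted_cost1.
    have := sorted_cost_catl [:: (rs`_t, s)] (online_pairs S r).
    by rewrite cat1s -pE; lra.
  exists 0%N; split; first by rewrite mul0r online_len_ge0.
  rewrite recE sM -[in changes _ _ t]sM changes_rcons addn0 mulr0 addr0.
  (* For a positive [B], [x * B <= W <= online_len S r <= kappa * opt S r <= 2 * kappa * B], so
     [x <= 2 * kappa] and the requests of the closed phase can be charged [2 * kappa] each. *)
  apply: le_trans rec _; rewrite -aR mulrDr lerD2l [leRHS]mulrC.
  have [t0|t0] := posnP t; first by rewrite t0 sub0n !mul0r.
  have Bp := B0 t0; rewrite ler_wpM2l ?ler0n // -(ler_pM2r Bp).
  apply: le_trans xW _; apply: (@le_trans _ _ (online_len S r)).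
    exact: Wl.
  apply: le_trans (len_le (ltnW tn)) _; rewrite -/r [2%:R * kappa]mulrC -mulrA.
  by rewrite ler_wpM2l.
have {stay} stay : opt S r' <= 2%:R * B by rewrite leNgt stay.
have B_gt0 : 0 < B by lra.
case: ifP recE => [rebuild|/negbT keep] recE.
  rewrite /invariant -/r' -/r.
  set g := drop a r'; set b := drop a (servers S r').
  have sgb : size g = size b by rewrite !size_drop size_servers.
  have tr : take a r' = take a r by rewrite rE -cats1 takel_cat ?sr.
  have ta : take a r' = take a rs by rewrite /r' take_takel // ltnW.
  have ea : servers S r' = servers S (take a rs) ++ b.
    by rewrite -[LHS](cat_take_drop a) take_servers ta.
  have pb := perm_rematch sgb.
  split.
  - split.
    + by rewrite size_cat sta size_rematch /g size_drop sr' subnKC // ltnW.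
    + exact: ltnW.
    + rewrite [X in perm_eq _ X]ea; apply: perm_cat; [exact: pMa|exact: pb].
    + by rewrite take_size_cat.
  - by split=> //; exact: le_trans Bo om.
  - by rewrite online_len_ge0 lexx subrr ltW.
  - rewrite take_size_cat // drop_size_cat // tr; split=> //.
    rewrite subrr addr0 -/g cost_rematch //.
    have := sorted_cost_catl (zip g b) (online_pairs S (take a rs)).
    have -> : sorted_cost (zip g b ++ online_pairs S (take a rs)) = sorted_cost (online_pairs S r').
      have e : rev (online_pairs S r') = rev (online_pairs S (take a rs)) ++ zip g b.
        rewrite -!zip_servers -[X in zip X _](cat_take_drop a) ea zip_cat ?ta //.
        by rewrite size_servers.
      apply: sorted_cost_perm; rewrite perm_catC.
      apply: (@perm_trans _ (rev (online_pairs S r'))); last by rewrite perm_rev.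
      by rewrite e perm_cat2r perm_sym perm_rev.
    by have := online_cost_le (instance_take a inst); lra.
  (* The online length has grown by more than [B] since the last rebuilding, which pays for the step
     from [x] to [x + 1]. The [t - a] possible changes are covered by this increase of the factor of
     [t.+1 - a]. *)
  exists x.+1; split.
    by rewrite -natr1 mulrDl mul1r; lra.
  have ch : (changes M (take a M ++ rematch g b) t <= t - a)%N.
    by apply: changes_suffix => // i ia; rewrite nth_cat sta ia nth_take.
  rewrite recE natrD subSn // -!natr1.
  have chR : (changes M (take a M ++ rematch g b) t)%:R <= (t - a)%:R :> R by rewrite ler_nat.
  have : 0 <= (t - a)%:R :> R by []. have : 0 <= x%:R :> R by [].
  by move: rec chR; nra.
have trE : take a r' = take a r by rewrite rE -cats1 takel_cat ?sr.
have drE : drop a r' = rcons (drop a r) rs`_t by rewrite rE drop_rcons ?sr.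
rewrite -leNgt in keep; rewrite /invariant -/r' -/r; split.
- by split; rewrite ?size_rcons ?sM ?(leqW at') // -cats1 takel_cat ?sM.
- by split=> //; exact: le_trans Bo om.
- by split=> //; rewrite lE; apply: le_trans Wl _; rewrite lerDr normr_ge0.
- rewrite trE -[in take a (rcons _ _)]cats1 takel_cat ?sM //; split=> //.
  by rewrite drE drop_rcons ?sM // cost_rcons // lE; lra.
exists x; split=> //; rewrite recE -[in changes _ _ t]sM changes_rcons addn0.
apply: le_trans rec _; rewrite lerD2l ler_wpM2r ?ler0n // ler_nat subSn //.
Qed.

Lemma matching_ok : is_matching S rs (matching (run S rs (size rs))).
Proof.
have := invariant_run (leqnn _); case: (run _ _ _) => [[[M a] B] W] /=.
rewrite take_size => -[[sM _ pM _] _ _ _ _].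
have [u sub] := online_servers inst.
apply/and3P; split; first by rewrite sM.
  by rewrite (perm_uniq pM) rev_uniq.
by apply/allP => x; rewrite (perm_mem pM) mem_rev => /sub.
Qed.

Lemma matching_cost : cost rs (matching (run S rs (size rs))) <= 146%:R * opt S rs.
Proof.
have := invariant_run (leqnn _); case: (run _ _ _) => [[[M a] B] W] /=.
rewrite take_size => -[[sM aM _ _] [_ Bo oB _] [W0 Wl lW] [cP cQ] _].
have -> : cost rs M = cost (take a rs) (take a M) + cost (drop a rs) (drop a M).
  by rewrite -cost_cat ?cat_take_drop // ?size_drop ?sM // !size_takel ?sM.
lra.
Qed.

Lemma recourse_le : (recourse (size rs))%:R <= 2%:R * kappa * (size rs)%:R.
Proof.
have [->|n0] := posnP (size rs); first by rewrite /recourse big_ord0 mulr0.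
have := invariant_run (leqnn _); case: (run _ _ _) => [[[M a] B] W] /=.
have := len_le (leqnn _).
rewrite take_size => lk -[[sM aM _ _] [B0 Bo oB _] [W0 Wl lW] _ [x [xW rec]]].
apply: le_trans rec _.
have <- : a%:R + (size rs - a)%:R = (size rs)%:R :> R by rewrite -natrD subnKC.
have Bp := B0 n0; rewrite mulrDr lerD2l [leRHS]mulrC ler_wpM2l ?ler0n // -(ler_pM2r Bp).
apply: le_trans xW _; apply: le_trans Wl _; apply: le_trans lk _.
by rewrite [2%:R * kappa]mulrC -mulrA ler_wpM2l.
Qed.

End OneInstance.
End Rebuilding.

(** * The logarithmic number of levels and the resulting recourse *)

Section Recourse.
Variable R : realType.

(** The factor 2 comes from [(3/2)^2 >= 2], the summand 11 from [2^11 >= 1201]. *)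
Definition log_levels (n : nat) : nat := 2 * (11 + up_log 2 n).

Definition len_ratio (n : nat) : R := 49%:R + 2304%:R * (log_levels n)%:R.

Lemma log_levels_enough n : 1201%:R * n%:R <= (3%:R / 2%:R) ^+ log_levels n :> R.
Proof.
rewrite /log_levels exprM.
apply: (@le_trans _ _ (2%:R ^+ (11 + up_log 2 n))); last first.
  by apply: lerXn2r; rewrite ?nnegrE; lra.
have nu : (n <= 2 ^ up_log 2 n)%N by exact: up_logP.
rewrite -natrX -natrM ler_nat expnD.
exact: (leq_mul (isT : (1201 <= 2 ^ 11)%N) nu).
Qed.

Lemma len_ratio_ge0 n : 0 <= len_ratio n.
Proof. apply: addr_ge0; first exact: ler0n. apply: mulr_ge0; exact: ler0n. Qed.

Lemma len_ratioP (S : {fset R}) (rs : seq R) : instance S rs ->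
  forall t, (t <= size rs)%N ->
  online_len S (take t rs) <= len_ratio (size rs) * opt S (take t rs).
Proof.
move=> inst t tn; have st : size (take t rs) = t by rewrite size_takel.
have [t0|t0] := posnP t; first by rewrite t0 take0 opt_nil mulr0 /online_len big_nil.
apply: online_len_le; rewrite ?st //; first exact: instance_take.
apply: le_trans (log_levels_enough _); apply: ler_wpM2l; first exact: ler0n.
by rewrite ler_nat.
Qed.

Definition rebuilding_algorithm : online_algorithm R :=
  @OnlineAlgorithm R (fun S rs => matching (run S rs (size rs)))
    (fun S rs inst => matching_ok inst (len_ratio_ge0 _) (len_ratioP inst)).

(** By [run_take], the matching computed for a prefix is the one through which the run on the whole
    sequence passes. *)
Lemma reassignmentsE (S : {fset R}) (rs : seq R) :
  reassignments rebuilding_algorithm S rs = recourse S rs (size rs).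
Proof.
apply: eq_bigr => t _; rewrite /step_reassignments /changes /=.
have tn := ltn_ord t.
by rewrite !size_takel ?(ltnW tn) // !run_take.
Qed.

(** With [u = up_log 2 n], both [(u - 1) * ln 2] and [ln 2] are at most [ln n]. Hence
    [2 * (12 + (u - 1)) * ln 2 <= 26 * ln n]. *)
Lemma len_ratio_ln n : (1 < n)%N -> len_ratio n <= (49%:R + 2304%:R * 26%:R) / ln 2%:R * ln n%:R.
Proof.
move=> n1; have n0 : (0 < n)%N by exact: ltnW.
have l2 : 0 < ln 2%:R :> R by rewrite ln_gt0 // ltr1n.
have ln2n : ln 2%:R <= ln n%:R :> R by rewrite ler_ln ?posrE ?ltr0n // ler_nat.
have /andP[low _] := up_log_bounds (isT : 1 < 2)%N n1.
have : ln (2%:R ^+ (up_log 2 n).-1) <= ln n%:R :> R.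
  by rewrite ler_ln ?posrE ?exprn_gt0 ?ltr0n // -natrX ler_nat ltnW.
rewrite lnXn // -[_ *+ _]mulr_natl => H.
have u1 : (up_log 2 n)%:R = ((up_log 2 n).-1)%:R + 1 :> R.
  by rewrite natr1 prednK // up_log_gt0.
rewrite mulrAC ler_pdivlMr // /len_ratio /log_levels natrM natrD u1.
move: H l2 ln2n; lra.
Qed.

End Recourse.

Theorem theorem1 (R : realType) :
  exists (alpha : R) (A : online_algorithm R),
    [/\ 1 <= alpha,
        competitive alpha A
      & exists C : R, forall (S : {fset R}) (rs : seq R), instance S rs ->
          (reassignments A S rs)%:R <= C * ((size rs)%:R * ln (size rs)%:R)].
Proof.
exists 146%:R, (rebuilding_algorithm R); split; first by lra.
  by move=> S rs inst; exact: matching_cost inst (len_ratio_ge0 _ _) (len_ratioP inst).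
exists (2%:R * ((49%:R + 2304%:R * 26%:R) / ln 2%:R)) => S rs inst; rewrite reassignmentsE.
(* For at most one request the bound is 0, and there is no earlier request to reassign. *)
have [n1|n1] := ltnP 1 (size rs); last first.
  case: (size rs) n1 => [|[|//]] _; first by rewrite /recourse big_ord0 mul0r mulr0.
  rewrite ln1 !mulr0 /recourse big_ord1 /changes (_ : #|_| = 0%N) //.
  by apply: eq_card0 => -[].
apply: le_trans (recourse_le inst (len_ratio_ge0 _ _) (len_ratioP inst)) _.
have := @len_ratio_ln R _ n1; set K := _ / _; set l := ln _ => H.
apply: (@le_trans _ _ (2%:R * (K * l) * (size rs)%:R)); last first.
  by rewrite le_eqVlt; apply/orP; left; apply/eqP; ring.
by apply: ler_wpM2r; [exact: ler0n|apply: ler_wpM2l].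
Qed.
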